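(* Let $K$ be a field, let $(Q,I)$ be a gentle quiver with corresponding (finite-dimensional) gentle algebra $A=KQ/I$, let $Sp$ be an admissible set of special vertices of $(Q,I)$, and let $\hat A=K\hat Q/\hat I$ be the skewed-gentle algebra arising from the skewed-gentle triple $(Q,Sp,I)$. Then $$\det C_{\hat A}(q)=\det C_A(q),$$ and thus, in particular, the determinants of the ordinary Cartan matrices coincide, i.e. $\det C_{\hat A}=\det C_A$.
   Context: A quiver $Q$ is a finite directed graph (loops and multiple arrows allowed) with vertex set $Q_0$; for an arrow $\alpha$, $s(\alpha)$ is its start vertex and $t(\alpha)$ its end vertex. Paths are read from left to right: an oriented path of length $r\ge 1$ is a sequence $\alpha_1\alpha_2\cdots\alpha_r$ of arrows with $t(\alpha_i)=s(\alpha_{i+1})$, and each vertex $v$ has a trivial path $e_v$ of length $0$. The path algebra $KQ$ has all oriented paths as $K$-basis, and multiplication is concatenation (zero if the paths cannot be concatenated). An ideal $I\subset KQ$ is admissible if $I\subseteq J^2$, where $J$ is the ideal generated by the arrows. A pair $(Q,I)$ with $I$ an admissible ideal of $KQ$ is a gentle quiver if: (i) each vertex is the start point of at most two arrows and the end point of at most two arrows; (ii) for each arrow $\alpha$ there is at most one arrow $\beta$ with $\alpha\beta\notin I$ and at most one arrow $\gamma$ with $\gamma\alpha\notin I$; (iii) $I$ is generated by paths of length $2$; (iv) for each arrow $\alpha$ there is at most one arrow $\beta'$ with $t(\alpha)=s(\beta')$ and $\alpha\beta'\in I$, and at most one arrow $\gamma'$ with $t(\gamma')=s(\alpha)$ and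 $\gamma'\alpha\in I$. A finite-dimensional algebra of the form $KQ/I$ with $(Q,I)$ gentle is called a gentle algebra; finite-dimensionality of $KQ/I$ is always assumed for gentle quivers. The valency of a vertex is the number of incoming arrows plus the number of outgoing arrows (a loop counts twice). A set $Sp\subseteq Q_0$ is an admissible set of special vertices of $(Q,I)$ if the pair $(Q^{\mathrm{sp}},I^{\mathrm{sp}})$, obtained from $(Q,I)$ by adding at each $v\in Sp$ a loop $\varepsilon_v$ with the additional relation $\varepsilon_v^2=0$ (all other relations remaining those of $I$), is again gentle, with $KQ^{\mathrm{sp}}/I^{\mathrm{sp}}$ again finite-dimensional (no nonzero paths of arbitrary length). Then $(Q,Sp,I)$ is called a skewed-gentle triple. (In particular a special vertex has valency $0$ or $1$, or valency $2$ with a zero relation at it not coming from a loop.) Given a skewed-gentle triple $(Q,Sp,I)$, the quiver with relations $(\hat Q,\hat I)$ is constructed as follows. Non-special vertices of $Q$ are vertices of $\hat Q$; each $v\in Sp$ is replaced by two vertices $v^+,v^-$. Arrows between non-special vertices are kept. An arrow $a$ from a non-special vertex $w$ to a special vertex $v$ (resp. from $v$ to $w$) is replaced by two arrows $a^{\pm}:w\to v^{\pm}$ (resp. $a^{\pm}:v^{\pm}\to w$); an arrow between two special vertices $v,w$ is replaced by four arrows, one between each of $v^{\pm}$ and each of $w^{\pm}$ (in the same direction). The new arrows are said to lie over $a$. The ideal $\hat I$ is generated by: for every relation $ab\in I$ (with $a,b$ arrows, $t(a)=s(b)$) such that $t(a)$ is non-special, all paths of length $2$ lying over $ab$; and for every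 special vertex $v$ of valency $2$ in $Q$ with its zero relation $ab\in I$, $t(a)=v=s(b)$, all differences of two paths of length $2$ lying over $ab$ which have the same start and end points and run through $v^+$ and $v^-$, respectively (mesh commutation relations). The $q$-Cartan matrix of a finite-dimensional algebra $A=KQ/I$ with $I$ generated by homogeneous relations (linear combinations of paths of the same length) is the $|Q_0|\times|Q_0|$ matrix $C_A(q)=(c_{ij}(q))$ over $\mathbb{Z}[q]$, $q$ an indeterminate, with $c_{ij}(q)=\sum_n \dim_K (e_iAe_j)_n\,q^n$, where $e_iAe_j=\bigoplus_n (e_iAe_j)_n$ is the grading induced by path length. (For $\hat A$ the same definition is used with $(\hat Q,\hat I)$.) The ordinary Cartan matrix is $C_A=C_A(1)$, with entries $\dim_K e_iAe_j$. *)

(* Defs.v *)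
From HB Require Import structures.
From mathcomp Require Import all_boot all_order all_algebra finmap.
From mathcomp Require Import boolp classical_sets.
From mathcomp.multinomials Require Import monalg.

Set Implicit Arguments.
Unset Strict Implicit.
Unset Printing Implicit Defensive.

Import GRing.Theory.

Local Open Scope fset_scope.
Local Open Scope classical_set_scope.
Local Open Scope quotient_scope.
Local Open Scope ring_scope.

Record quiver := Quiver {
  vertex :> finType;
  arrow : finType;
  src : arrow -> vertex;
  tgt : arrow -> vertex }.

Section Paths.
Variable Q : quiver.

Fixpoint walk (v : Q) (s : seq (arrow Q)) : bool :=
  if s is a :: s' then (src a == v) && walk (tgt a) s' else true.

Definition walk_end (v : Q) (s : seq (arrow Q)) : Q := last v (map (@tgt Q) s).

Lemma walk_cat v s1 s2 :
  walk v (s1 ++ s2) = walk v s1 && walk (walk_end v s1) s2.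
Proof. by elim: s1 v => //= a s1 IH v; rewrite IH andbA. Qed.

Lemma walk_end_cat v s1 s2 :
  walk_end v (s1 ++ s2) = walk_end (walk_end v s1) s2.
Proof. by rewrite /walk_end map_cat last_cat. Qed.

(* A path carries its start vertex, so that [(v, [::])] is the trivial path
   at [v].  Paths are read from left to right. *)
Definition qpath := {p : Q * seq (arrow Q) | walk p.1 p.2}.

HB.instance Definition _ := Choice.on qpath.

Definition pstart (p : qpath) : Q := (val p).1.
Definition parrows (p : qpath) : seq (arrow Q) := (val p).2.
Definition pend (p : qpath) : Q := walk_end (pstart p) (parrows p).
Definition plen (p : qpath) : nat := size (parrows p).

Definition triv_path (v : Q) : qpath :=
  exist (fun p : Q * seq (arrow Q) => walk p.1 p.2) (v, [::]) isT.

Lemma arrow_path_subproof (a : arrow Q) : walk (src a) [:: a].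
Proof. by rewrite /= eqxx. Qed.

Definition arrow_path (a : arrow Q) : qpath :=
  exist (fun p : Q * seq (arrow Q) => walk p.1 p.2)
    (src a, [:: a]) (arrow_path_subproof a).

(* [insub] never fails here, see [pcatP]. *)
Definition pcat (p q : qpath) : option qpath :=
  if pend p == pstart q
  then (insub (pstart p, parrows p ++ parrows q) : option {r | walk r.1 r.2})
  else None.

Lemma pcatP (p q : qpath) : pend p = pstart q ->
  exists2 r, pcat p q = Some r & val r = (pstart p, parrows p ++ parrows q).
Proof.
move=> epq; rewrite /pcat epq eqxx; case: insubP => [r _ er|]; first by exists r.
by rewrite /= walk_cat (valP p) -[walk_end _ _]/(pend p) epq (valP q).
Qed.

Lemma pcat_none (p q : qpath) : pend p <> pstart q -> pcat p q = None.
Proof. by move=> /eqP/negbTE npq; rewrite /pcat npq. Qed.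

Lemma pcatA (p q r : qpath) :
  obind (fun pq => pcat pq r) (pcat p q) = obind (pcat p) (pcat q r).
Proof.
have [epq|npq] := eqVneq (pend p) (pstart q); last first.
  rewrite (pcat_none (elimN eqP npq : pend p <> pstart q)) /=.
  have [eqr|nqr] := eqVneq (pend q) (pstart r); last first.
    by rewrite (pcat_none (elimN eqP nqr : pend q <> pstart r)).
  have [s -> es] := pcatP eqr; rewrite /= pcat_none //.
  by rewrite /pstart es => /eqP; rewrite (negbTE npq).
have [s -> es] := pcatP epq; rewrite /=.
have ends : pend s = pend q.
  by rewrite /pend {1}/pstart /parrows es /= walk_end_cat -/(pend p) epq.
have [eqr|nqr] := eqVneq (pend q) (pstart r); last first.
  rewrite (pcat_none (elimN eqP nqr : pend q <> pstart r)) /= pcat_none //.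
  by rewrite ends; apply/eqP.
have [t -> et] := pcatP eqr; rewrite /=.
have [u -> eu] := pcatP (etrans ends eqr).
have ept : pend p = pstart t by rewrite /pstart et.
have [w -> ew] := pcatP ept; congr Some; apply: val_inj; rewrite eu ew.
have [-> ->] : pstart s = pstart p /\ parrows s = parrows p ++ parrows q.
  by rewrite /pstart /parrows es.
by rewrite /parrows et catA.
Qed.

Lemma pcat_triv_l v (p : qpath) :
  pcat (triv_path v) p = if v == pstart p then Some p else None.
Proof.
case: eqP => [->|nvp]; last by rewrite pcat_none.
have [r -> er] := @pcatP (triv_path (pstart p)) p erefl.
by congr Some; apply: val_inj; rewrite er [RHS]surjective_pairing.
Qed.

Lemma pcat_triv_r v (p : qpath) :
  pcat p (triv_path v) = if v == pend p then Some p else None.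
Proof.
case: eqP => [->|nvp]; last by rewrite pcat_none // => /esym.
have [r -> er] := @pcatP p (triv_path (pend p)) erefl.
by congr Some; apply: val_inj; rewrite er /= cats0 [RHS]surjective_pairing.
Qed.

End Paths.

Definition path_algebra (K : fieldType) (Q : quiver) : Type := {malg K[qpath Q]}.

HB.instance Definition _ (K : fieldType) (Q : quiver) :=
  GRing.Lmodule.copy (path_algebra K Q) {malg K[qpath Q]}.

(* Locked: unfolding the finitely supported functions makes unification
   diverge. *)
HB.lock Definition pathE (K : fieldType) (Q : quiver) (p : qpath Q) :
  path_algebra K Q := << p >>.

Definition opathE (K : fieldType) (Q : quiver) (p : option (qpath Q)) :
    path_algebra K Q :=
  if p is Some r then pathE K r else 0.

HB.lock Definition pa_mul (K : fieldType) (Q : quiver) (x y : path_algebra K Q) :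
    path_algebra K Q :=
  \sum_(p <- msupp x) \sum_(q <- msupp y)
    (x@_p * y@_q) *: opathE K (pcat p q).

Section PathAlgebra.
Variables (K : fieldType) (Q : quiver).
Local Notation KQ := (path_algebra K Q).
Local Notation pa_mul := (@pa_mul K Q).
Local Notation pathE := (@pathE K Q).
Local Notation opathE := (@opathE K Q).
Implicit Types (x y z : KQ) (p q r : qpath Q).

Definition pa_one : KQ := \sum_(v : Q) pathE (triv_path v).

Lemma pa_mulw (d1 d2 : {fset qpath Q}) x y :
  (msupp x `<=` d1)%fset -> (msupp y `<=` d2)%fset ->
  pa_mul x y =
  \sum_(p <- d1) \sum_(q <- d2) (x@_p * y@_q) *: opathE (pcat p q).
Proof.
move=> le1 le2; rewrite unlock (big_fset_incl _ le1) /=; last first.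
  by move=> p _ /mcoeff_outdom xp; rewrite big1 // => q _; rewrite xp mul0r scale0r.
apply/eq_bigr => p _; apply/big_fset_incl => // q _ /mcoeff_outdom ->.
by rewrite mulr0 scale0r.
Qed.

Lemma pa_mulDl : left_distributive pa_mul +%R.
Proof.
move=> x y z; have s := fsubset_refl (msupp z).
rewrite (pa_mulw (msuppD_le x y) s) (pa_mulw (fsubsetUl _ (msupp y)) s).
rewrite (pa_mulw (fsubsetUr (msupp x) _) s) -big_split; apply/eq_bigr => p _.
by rewrite -big_split; apply/eq_bigr => q _; rewrite mcoeffD mulrDl scalerDl.
Qed.

Lemma pa_mulDr : right_distributive pa_mul +%R.
Proof.
move=> z x y; have s := fsubset_refl (msupp z).
rewrite (pa_mulw s (msuppD_le x y)) (pa_mulw s (fsubsetUl _ (msupp y))).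
rewrite (pa_mulw s (fsubsetUr (msupp x) _)) -big_split; apply/eq_bigr => p _.
by rewrite -big_split; apply/eq_bigr => q _; rewrite mcoeffD mulrDr scalerDl.
Qed.

Lemma pa_mul0l y : pa_mul 0 y = 0.
Proof. by apply: (addrI (pa_mul 0 y)); rewrite -pa_mulDl !addr0. Qed.

Lemma pa_mul0r x : pa_mul x 0 = 0.
Proof. by apply: (addrI (pa_mul x 0)); rewrite -pa_mulDr !addr0. Qed.

Lemma pa_mulZl c x y : pa_mul (c *: x) y = c *: pa_mul x y.
Proof.
rewrite (pa_mulw (msuppZ_le c x) (fsubset_refl _)).
rewrite (pa_mulw (fsubset_refl (msupp x)) (fsubset_refl (msupp y))) scaler_sumr.
apply/eq_bigr => p _; rewrite scaler_sumr; apply/eq_bigr => q _.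
by rewrite mcoeffZ scalerA mulrA.
Qed.

Lemma pa_mulZr c x y : pa_mul x (c *: y) = c *: pa_mul x y.
Proof.
rewrite (pa_mulw (fsubset_refl _) (msuppZ_le c y)).
rewrite (pa_mulw (fsubset_refl (msupp x)) (fsubset_refl (msupp y))) scaler_sumr.
apply/eq_bigr => p _; rewrite scaler_sumr; apply/eq_bigr => q _.
by rewrite mcoeffZ scalerA mulrCA.
Qed.

Lemma pa_mulEE p q : pa_mul (pathE p) (pathE q) = opathE (pcat p q).
Proof.
have sE r : (msupp (pathE r) `<=` [fset r])%fset by rewrite unlock msuppU_le.
rewrite (pa_mulw (sE p) (sE q)) !big_seq_fset1 unlock !mcoeffUU.
by rewrite mulr1 scale1r.
Qed.

Lemma pathE_sum x : x = \sum_(p <- msupp x) x@_p *: pathE p.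
Proof.
rewrite {1}[x]monalgE; apply: eq_bigr => p _; apply/malgP => q.
rewrite [RHS]mcoeffZ unlock [X in _ * X]mcoeffU [LHS]mcoeffU; case: (p == q);
  by rewrite ?mulr1 ?mulr0.
Qed.

Lemma pa_ind (P : KQ -> Prop) :
  P 0 -> (forall x y, P x -> P y -> P (x + y)) ->
  (forall c x, P x -> P (c *: x)) -> (forall p, P (pathE p)) -> forall x, P x.
Proof.
move=> P0 PD PZ PE x; rewrite [x]pathE_sum.
by apply: (big_ind P) => // p _; apply/PZ/PE.
Qed.

Lemma pa_mulA : associative pa_mul.
Proof.
have HE p q r : pa_mul (pathE p) (pa_mul (pathE q) (pathE r)) =
                pa_mul (pa_mul (pathE p) (pathE q)) (pathE r).
  rewrite (pa_mulEE p q) (pa_mulEE q r); have := congr1 opathE (pcatA p q r).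
  case: (pcat p q) => [pq|]; case: (pcat q r) => [qr|] /= E;
    by rewrite ?(pa_mul0l (pathE r)) ?(pa_mul0r (pathE p)) ?pa_mulEE.
have H1 x y : (forall r, pa_mul x (pa_mul y (pathE r)) =
                         pa_mul (pa_mul x y) (pathE r)) ->
    forall z, pa_mul x (pa_mul y z) = pa_mul (pa_mul x y) z.
  move=> H; elim/pa_ind => [|z z' IH IH'|c z IH|//].
  - by rewrite !pa_mul0r.
  - by rewrite !pa_mulDr IH IH'.
  - by rewrite !(pa_mulZr c) IH.
have H2 x z : (forall q, pa_mul x (pa_mul (pathE q) z) =
                         pa_mul (pa_mul x (pathE q)) z) ->
    forall y, pa_mul x (pa_mul y z) = pa_mul (pa_mul x y) z.
  move=> H; elim/pa_ind => [|y y' IH IH'|c y IH|//].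
  - by rewrite pa_mul0r pa_mul0l pa_mul0r.
  - by rewrite pa_mulDr !pa_mulDl pa_mulDr IH IH'.
  - rewrite -[RHS]/((pa_mul^~ z) (pa_mul x (c *: y))).
    rewrite [X in _ = (pa_mul^~ z) X]pa_mulZr [RHS]pa_mulZl -IH.
    by rewrite [X in pa_mul x X]pa_mulZl [LHS]pa_mulZr.
have H3 y z : (forall p, pa_mul (pathE p) (pa_mul y z) =
                         pa_mul (pa_mul (pathE p) y) z) ->
    forall x, pa_mul x (pa_mul y z) = pa_mul (pa_mul x y) z.
  move=> H; elim/pa_ind => [|x x' IH IH'|c x IH|//].
  - by rewrite !pa_mul0l.
  - by rewrite !pa_mulDl IH IH'.
  - rewrite [X in _ = pa_mul X z]pa_mulZl [RHS]pa_mulZl -IH.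
    by rewrite [LHS]pa_mulZl.
move=> x y z; apply: H3 => p; apply: H2 => q; apply: H1 => r; exact: HE.
Qed.

Lemma pa_mul1l : left_id pa_one pa_mul.
Proof.
move=> x; elim/pa_ind: x => [|x y IH IH'|c x IH|p]; first exact: pa_mul0r.
- by rewrite pa_mulDr IH IH'.
- by rewrite (pa_mulZr c) IH.
rewrite /pa_one (big_morph (pa_mul^~ _) (fun _ _ => pa_mulDl _ _ _) (pa_mul0l _)).
rewrite (bigD1 (pstart p)) //= big1 => [|v /negbTE nv];
  by rewrite pa_mulEE pcat_triv_l ?eqxx ?nv ?addr0.
Qed.

Lemma pa_mul1r : right_id pa_one pa_mul.
Proof.
move=> x; elim/pa_ind: x => [|x y IH IH'|c x IH|p]; first exact: pa_mul0l.
- by rewrite pa_mulDl IH IH'.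
- by rewrite (pa_mulZl c) IH.
rewrite /pa_one (big_morph (pa_mul _) (fun _ _ => pa_mulDr _ _ _) (pa_mul0r _)).
rewrite (bigD1 (pend p)) //= big1 => [|v /negbTE nv];
  by rewrite pa_mulEE pcat_triv_r ?eqxx ?nv ?addr0.
Qed.

End PathAlgebra.

HB.instance Definition _ (K : fieldType) (Q : quiver) :=
  GRing.Zmodule_isPzRing.Build (path_algebra K Q)
    (@pa_mulA K Q) (@pa_mul1l K Q) (@pa_mul1r K Q)
    (@pa_mulDl K Q) (@pa_mulDr K Q).

Section PathAlgebraTheory.
Variables (K : fieldType) (Q : quiver).
Local Notation KQ := (path_algebra K Q).

Definition idem (v : Q) : KQ := pathE K (triv_path v).
Definition arr (a : arrow Q) : KQ := pathE K (arrow_path a).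

Lemma pathEM (p q : qpath Q) : pathE K p * pathE K q = opathE K (pcat p q).
Proof. exact: pa_mulEE. Qed.

Lemma pa_scaleAl c (x y : KQ) : c *: (x * y) = (c *: x) * y.
Proof. by rewrite [RHS]pa_mulZl. Qed.

Lemma pa_scaleAr c (x y : KQ) : c *: (x * y) = x * (c *: y).
Proof. by rewrite [RHS]pa_mulZr. Qed.

End PathAlgebraTheory.

Definition two_sided_ideal (R : pzRingType) (I : set R) : Prop :=
  [/\ I 0, forall x y, I x -> I y -> I (x - y),
      forall a x, I x -> I (a * x) & forall a x, I x -> I (x * a)].

Record ideal (R : pzRingType) := Ideal {
  ideal_set :> R -> Prop;
  idealP : two_sided_ideal ideal_set }.

Section Ideals.
Variable R : pzRingType.

Lemma gen_ideal_subproof (G : set R) :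
  two_sided_ideal (smallest (@two_sided_ideal R) G).
Proof.
split.
- by move=> I [[? _ _ _] _].
- by move=> x y Ix Iy I HI; have [[_ + _ _] _] := HI; apply; [exact: Ix|exact: Iy].
- by move=> a x Ix I HI; have [[_ _ + _] _] := HI; apply; exact: Ix.
- by move=> a x Ix I HI; have [[_ _ _ +] _] := HI; apply; exact: Ix.
Qed.

Definition gen_ideal (G : set R) : ideal R := Ideal (gen_ideal_subproof G).

Definition ideal_pred (I : ideal R) : {pred R} := fun x => `[< I x >].

Lemma ideal_predE (I : ideal R) x : (x \in ideal_pred I) = `[< I x >].
Proof. by []. Qed.

Lemma ideal_pred_zmod (I : ideal R) : zmod_closed (ideal_pred I).
Proof.
have [I0 IB _ _] := idealP I; split=> [|x y]; rewrite !ideal_predE.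
  exact/asboolP.
by move=> /asboolP Ix /asboolP Iy; apply/asboolP/IB.
Qed.

HB.instance Definition _ (I : ideal R) :=
  GRing.isZmodClosed.Build R (ideal_pred I) (ideal_pred_zmod I).

End Ideals.

Definition quotient_algebra (K : fieldType) (Q : quiver)
    (I : ideal (path_algebra K Q)) : Type :=
  Quotient.quot (ideal_pred I : zmodClosed _).

Section QuotientAlgebra.
Variables (K : fieldType) (Q : quiver) (I : ideal (path_algebra K Q)).
Local Notation KQ := (path_algebra K Q).
Local Notation A := (quotient_algebra I).

HB.instance Definition _ := GRing.Zmodule.copy A (Quotient.quot (ideal_pred I : zmodClosed _)).

Definition qpi (x : KQ) : A := \pi_(Quotient.quot (ideal_pred I : zmodClosed _)) x.
Definition qrepr (a : A) : KQ :=
  repr (a : Quotient.quot (ideal_pred I : zmodClosed _)).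

Lemma qreprK : cancel qrepr qpi.
Proof. exact: reprK. Qed.

Lemma qpiP x y : qpi x = qpi y <-> I (x - y).
Proof.
have := Quotient.idealrBE (ideal_pred I : zmodClosed _) x y.
rewrite ideal_predE => E; split=> [/eqP|/asboolP]; rewrite ?[_ == _](esym E).
  by move=> /asboolP.
by rewrite E => /eqP.
Qed.

Lemma qpiD x y : qpi (x + y) = qpi x + qpi y.
Proof. exact: (raddfD (\pi_(Quotient.quot (ideal_pred I : zmodClosed _)))). Qed.

Lemma qpi_repr x : I (qrepr (qpi x) - x).
Proof. by apply/qpiP; rewrite qreprK. Qed.

Lemma idealD x y : I x -> I y -> I (x + y).
Proof.
have [I0 IB _ _] := idealP I => Ix Iy.
by rewrite -[y]opprK -[- y]sub0r; apply: (IB) => //; apply: IB.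
Qed.

Definition qone : A := qpi 1.
Definition qmul (a b : A) : A := qpi (qrepr a * qrepr b).
Definition qscale (c : K) (a : A) : A := qpi (c *: qrepr a).

Lemma qmulE x y : qmul (qpi x) (qpi y) = qpi (x * y).
Proof.
apply/qpiP; have [_ _ Il Ir] := idealP I.
rewrite -[_ * _](subrK (x * qrepr (qpi y))) -mulrBl -addrA -mulrBr.
by apply: idealD; [apply: Ir|apply: Il]; apply: qpi_repr.
Qed.

Lemma qscaleE c x : qscale c (qpi x) = qpi (c *: x).
Proof.
apply/qpiP; have [_ _ Il _] := idealP I.
by rewrite -scalerBr -[X in _ *: X]mul1r pa_scaleAl; apply/Il/qpi_repr.
Qed.

Lemma qmulA : associative qmul.
Proof.
by move=> a b c; rewrite -[a]qreprK -[b]qreprK -[c]qreprK !qmulE mulrA.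
Qed.

Lemma qmul1l : left_id qone qmul.
Proof. by move=> a; rewrite -[a]qreprK qmulE mul1r. Qed.

Lemma qmul1r : right_id qone qmul.
Proof. by move=> a; rewrite -[a]qreprK qmulE mulr1. Qed.

Lemma qmulDl : left_distributive qmul +%R.
Proof.
move=> a b c; rewrite -[a]qreprK -[b]qreprK -[c]qreprK.
by rewrite -qpiD !qmulE -qpiD mulrDl.
Qed.

Lemma qmulDr : right_distributive qmul +%R.
Proof.
move=> a b c; rewrite -[a]qreprK -[b]qreprK -[c]qreprK.
by rewrite -qpiD !qmulE -qpiD mulrDr.
Qed.

HB.instance Definition _ :=
  GRing.Zmodule_isPzRing.Build A qmulA qmul1l qmul1r qmulDl qmulDr.

Lemma qscaleA c d a : qscale c (qscale d a) = qscale (c * d) a.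
Proof. by rewrite -[a]qreprK !qscaleE scalerA. Qed.

Lemma qscale1 : left_id 1 qscale.
Proof. by move=> a; rewrite -[a]qreprK qscaleE scale1r. Qed.

Lemma qscaleDr : right_distributive qscale +%R.
Proof.
by move=> c a b; rewrite -[a]qreprK -[b]qreprK -qpiD !qscaleE -qpiD scalerDr.
Qed.

Lemma qscaleDl a : {morph qscale^~ a : c d / c + d}.
Proof. by move=> c d; rewrite -[a]qreprK !qscaleE -qpiD scalerDl. Qed.

HB.instance Definition _ :=
  GRing.Zmodule_isLmodule.Build K A qscaleA qscale1 qscaleDr qscaleDl.

Lemma qpiM x y : qpi (x * y) = qpi x * qpi y.
Proof. by rewrite [RHS]qmulE. Qed.

Lemma qpiZ c x : qpi (c *: x) = c *: qpi x.
Proof. by rewrite [RHS]qscaleE. Qed.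

End QuotientAlgebra.

Section Dimension.
Variables (K : fieldType) (V : lmodType K).

Definition is_basis (W : set V) (n : nat) (b : 'I_n -> V) : Prop :=
  [/\ forall i, W (b i),
      forall c : 'I_n -> K, \sum_i c i *: b i = 0 -> forall i, c i = 0
    & forall w, W w -> exists c : 'I_n -> K, w = \sum_i c i *: b i].

(* Meant for linear subspaces [W]; the value is [0] if [W] is
   infinite-dimensional. *)
Definition dim (W : set V) : nat :=
  xget 0%N [set n | exists b : 'I_n -> V, is_basis W b].

Definition finite_dim : Prop :=
  exists n, exists b : 'I_n -> V, is_basis setT b.

End Dimension.

Section Cartan.
Variables (K : fieldType) (Q : quiver) (I : ideal (path_algebra K Q)).
Local Notation A := (quotient_algebra I).

Definition peirce (i j : Q) : set A :=
  [set qpi I (idem K i) * a * qpi I (idem K j) | a in setT].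

Definition degree_part (n : nat) : set A :=
  [set qpi I x | x in [set x : path_algebra K Q |
     forall p, p \in msupp x -> plen p = n]].

(* The degree [n] part of [e_i A e_j] is [e_i A_n e_j], as [e_i] and [e_j] are
   homogeneous of degree 0. *)
Definition peirce_part (i j : Q) (n : nat) : set A :=
  [set qpi I (idem K i) * a * qpi I (idem K j) | a in degree_part n].

(* The polynomial with coefficients [dim (e_i A e_j)_n]; it exists as soon as
   these vanish for large [n], e.g. if [A] is finite-dimensional and [I]
   is homogeneous, and is set to [0] otherwise. *)
Definition qcartan_entry (i j : Q) : {poly int} :=
  xget 0 [set c : {poly int} | forall n, c`_n = (dim (peirce_part i j n))%:Z].

Definition qcartan : 'M[{poly int}]_#|Q| :=
  \matrix_(i, j) qcartan_entry (enum_val i) (enum_val j).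

Definition cartan : 'M[int]_#|Q| :=
  \matrix_(i, j) (dim (peirce (enum_val i) (enum_val j)))%:Z.

End Cartan.

Definition arrow_ideal (K : fieldType) (Q : quiver) : ideal (path_algebra K Q) :=
  gen_ideal (range (@arr K Q)).

Definition ideal_square (R : pzRingType) (I : ideal R) : ideal R :=
  gen_ideal [set z | exists x y, [/\ I x, I y & z = x * y]].

(* If [a] and [b] cannot be concatenated then [arr a * arr b = 0] is in [I]. *)
Record gentle (K : fieldType) (Q : quiver) (I : ideal (path_algebra K Q)) : Prop :=
  Gentle {
  gentle_admissible : forall x, I x -> ideal_square (arrow_ideal K Q) x;
  gentle_out : forall v : Q, (#|[set a : arrow Q | src a == v]%SET| <= 2)%N;
  gentle_in : forall v : Q, (#|[set a : arrow Q | tgt a == v]%SET| <= 2)%N;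
  gentle_nonzero_r : forall a b b' : arrow Q,
    ~ I (arr K a * arr K b) -> ~ I (arr K a * arr K b') -> b = b';
  gentle_nonzero_l : forall a c c' : arrow Q,
    ~ I (arr K c * arr K a) -> ~ I (arr K c' * arr K a) -> c = c';
  gentle_quadratic : exists P : set (qpath Q),
    (forall p, P p -> plen p = 2%N) /\
    forall x, I x <-> gen_ideal [set pathE K p | p in P] x;
  gentle_zero_r : forall a b b' : arrow Q,
    tgt a = src b -> I (arr K a * arr K b) ->
    tgt a = src b' -> I (arr K a * arr K b') -> b = b';
  gentle_zero_l : forall a c c' : arrow Q,
    tgt c = src a -> I (arr K c * arr K a) ->
    tgt c' = src a -> I (arr K c' * arr K a) -> c = c' }.

Section Special.
Variables (K : fieldType) (Q : quiver) (I : ideal (path_algebra K Q)).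
Variable Sp : {set Q}.

Definition zero_relation (a b : arrow Q) : Prop :=
  tgt a = src b /\ I (arr K a * arr K b).

Definition sp_quiver : quiver :=
  {| vertex := vertex Q;
     arrow := (arrow Q + {v : Q | v \in Sp})%type;
     src := fun x => match x with inl a => src a | inr v => val v end;
     tgt := fun x => match x with inl a => tgt a | inr v => val v end |}.

Definition sp_arrow (a : arrow Q) : arrow sp_quiver := inl a.
Definition sp_loop (v : {v : Q | v \in Sp}) : arrow sp_quiver := inr v.

(* [I] is generated by the paths of length 2 it contains, so the relations
   inherited from [I] are the products [a b] of arrows lying in [I]. *)
Definition sp_ideal : ideal (path_algebra K sp_quiver) :=
  gen_ideal
    ([set x | exists a b, zero_relation a b /\
        x = arr K (sp_arrow a) * arr K (sp_arrow b)] `|`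
     [set x | exists v, x = arr K (sp_loop v) * arr K (sp_loop v)]).

Definition admissible_special : Prop :=
  gentle sp_ideal /\ finite_dim (quotient_algebra sp_ideal).

Definition valency (v : Q) : nat :=
  (#|[set a : arrow Q | tgt a == v]%SET| + #|[set a : arrow Q | src a == v]%SET|)%N.

(* [inr (v, true)] and [inr (v, false)] are [v^+] and [v^-]. *)
Definition hat_vertex : finType :=
  ({v : Q | v \notin Sp} + {v : Q | v \in Sp} * bool)%type.

Definition under (x : hat_vertex) : Q :=
  match x with inl v => val v | inr (v, _) => val v end.

(* The arrows over [a] are the triples [(x, a, y)] with [x] over the start and
   [y] over the end of [a]; so there are 1, 2 or 4 of them, according to the
   number of special end points of [a]. *)
Definition hat_arrow : finType :=
  {t : hat_vertex * arrow Q * hat_vertex |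
     (under t.1.1 == src t.1.2) && (under t.2 == tgt t.1.2)}.

Definition hat_quiver : quiver :=
  {| vertex := hat_vertex;
     arrow := hat_arrow;
     src := fun t : hat_arrow => (val t).1.1;
     tgt := fun t : hat_arrow => (val t).2 |}.

Definition arrow_under (t : arrow hat_quiver) : arrow Q :=
  (val (t : hat_arrow)).1.2.

Definition hat_zero_relations : set (path_algebra K hat_quiver) :=
  [set x | exists s t : arrow hat_quiver,
     [/\ zero_relation (arrow_under s) (arrow_under t),
         tgt (arrow_under s) \notin Sp, tgt s = src t
       & x = arr K s * arr K t]].

Definition hat_mesh_relations : set (path_algebra K hat_quiver) :=
  [set x | exists (v : {v : Q | v \in Sp}) (a b : arrow Q)
                  (s t s' t' : arrow hat_quiver),
     [/\ valency (val v) = 2%N, zero_relation a b & tgt a = val v] /\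
     [/\ arrow_under s = a, arrow_under t = b,
         arrow_under s' = a & arrow_under t' = b] /\
     [/\ src s = src s', tgt t = tgt t',
         tgt s = inr (v, true) /\ src t = inr (v, true)
       & tgt s' = inr (v, false) /\ src t' = inr (v, false)] /\
     x = arr K s * arr K t - arr K s' * arr K t'].

Definition hat_ideal : ideal (path_algebra K hat_quiver) :=
  gen_ideal (hat_zero_relations `|` hat_mesh_relations).

End Special.

(* Main.v *)
Require Import Defs.
From HB Require Import structures.
From mathcomp Require Import all_boot all_order all_algebra finmap.
From mathcomp Require Import boolp classical_sets.
From mathcomp.multinomials Require Import monalg.
Set Implicit Arguments.
Unset Strict Implicit.
Unset Printing Implicit Defensive.
Import GRing.Theory.
Local Open Scope ring_scope.

(** The Cartan matrices count paths.  A path of [Q] is nonzero in the gentle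
    algebra [A] iff it contains no zero relation, so [C_A(q) = 1 + P], where [P]
    is the generating function of nontrivial paths without zero relations
    ([monomial_cartan]).  In the skewed-gentle algebra the relations at special
    vertices only identify the two ways to pass through the vertex.  Hence, for
    [x] over [i] and [y] over [j], the nontrivial nonzero paths from [x] to [y]
    correspond to the nontrivial paths from [i] to [j] all of whose zero relations
    sit at special vertices.  With [N] their generating function this says
    [C_hat = 1 + u N u^T], where [u] is the incidence matrix of the projection
    from the vertices of the new quiver to those of [Q] ([hat_cartan]).  Both
    statements rest on a general principle: if an ideal is spanned by some paths
    and by differences of other paths, the classes of the surviving paths form a
    basis of the quotient ([ideal_red], [dim_peirce]).

    Let [S] be the diagonal matrix that marks special vertices.  Since [u^T u] is
    [1 + S], one has [det C_hat = det (1 + N u^T u) = det (1 + N (1 + S))]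
    ([det_one_addC]).  Every passage of a path through a special vertex is a zero
    relation ([special_zero]); cutting a path at its first such passage gives
    [N = P + P S N] ([path_poly_split]).  Thus [(1 - P S) N = P], which yields both
    [(1 - P S) (1 + N (1 + S)) = 1 + P] and [(1 - P S) (1 + N S) = 1].  By the
    second equation [det (1 - P S)] is a unit of [Z[q]]; it has constant term [1]
    and so equals [1].  The first one then gives [det C_hat = det C_A]
    ([det_resolvent_X]).

    For [N] to have polynomial entries the paths it counts must have bounded
    length.  This follows from finite-dimensionality of the algebra obtained by
    adding loops at the special vertices: inserting these loops turns such paths
    into nonzero ones ([insert_loops], [hat_walk_bounded]).  The ordinary Cartan
    matrices are the values at [q = 1]. *)

(** * Determinants and the resolvent equation *)

(** Both sides are the determinant of the block matrix with rows [1, -A] and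
    [B, 1], which is an upper times a lower block triangular matrix, and also
    the other way round. *)
Lemma det_one_addC (R : comPzRingType) m n (A : 'M[R]_(m, n)) (B : 'M_(n, m)) :
  \det (1%:M + A *m B) = \det (1%:M + B *m A).
Proof.
have E1 : block_mx 1%:M (- A) B 1%:M =
    block_mx 1%:M (- A) 0 1%:M *m block_mx (1%:M + A *m B) 0 B 1%:M.
  rewrite mulmx_block !mul1mx !mul0mx !mulmx1 !add0r mulNmx.
  by rewrite addrK.
have E2 : block_mx 1%:M (- A) B 1%:M =
    block_mx 1%:M 0 B 1%:M *m block_mx 1%:M (- A) 0 (1%:M + B *m A).
  rewrite mulmx_block !mul1mx !mul0mx !mulmx1 !addr0 mulmxN.
  by rewrite [1%:M + B *m A]addrC addKr.
have := congr1 determinant E1; rewrite E2 !det_mulmx !det_ublock !det_lblock.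
by rewrite !det1 !mul1r !mulr1.
Qed.

Lemma resolvent_mul (R : pzRingType) n (N P S : 'M[R]_n) :
  N = P + P *m S *m N -> (1%:M - P *m S) *m N = P.
Proof. by move=> EN; rewrite mulmxBl mul1mx {1}EN addrK. Qed.

(** By [resolvent_mul] the matrices on the left have the product
    [(1 - P S) + P (1 + S)]. *)
Lemma det_resolvent (R : comPzRingType) n (N P S : 'M[R]_n) :
  N = P + P *m S *m N ->
  \det (1%:M - P *m S) * \det (1%:M + N *m (1%:M + S)) = \det (1%:M + P).
Proof.
move=> EN; rewrite -det_mulmx; congr (\det _).
rewrite mulmxDr mulmx1 mulmxA (resolvent_mul EN).
by rewrite mulmxDr mulmx1 addrACA addNr addr0.
Qed.

(** By [resolvent_mul] the matrix [1 + N S] is inverse to [1 - P S]. *)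
Lemma det_unit_resolvent (R : comPzRingType) n (N P S : 'M[R]_n) :
  N = P + P *m S *m N -> \det (1%:M - P *m S) * \det (1%:M + N *m S) = 1.
Proof.
move=> EN; rewrite -det_mulmx -[RHS](det1 R n); congr (\det _).
by rewrite mulmxDr mulmx1 mulmxA (resolvent_mul EN) subrK.
Qed.

(** A unit of [Z[q]] is a constant, so its value at [0] determines it. *)
Lemma poly_unit_at0 (p q : {poly int}) : p * q = 1 -> p.[0] = 1 -> p = 1.
Proof.
move=> pq p0; have : p \is a GRing.unit by apply/unitrPr; exists q.
rewrite poly_unitE => /andP[/size_poly1P[c _ pE] _].
by move: p0; rewrite pE hornerC => ->.
Qed.

(** The factor [det (1 - P S)] of [det_resolvent] is a unit of [Z[q]] and has
    constant term [1], because [P] vanishes at [q = 0]; so it is [1]. *)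
Lemma det_resolvent_X n (N P S : 'M[{poly int}]_n) :
  N = P + P *m S *m N -> (forall i j, (P i j).[0] = 0) ->
  \det (1%:M + N *m (1%:M + S)) = \det (1%:M + P).
Proof.
move=> EN P0; rewrite -(det_resolvent EN).
rewrite (poly_unit_at0 (det_unit_resolvent EN)) ?mul1r //.
rewrite -horner_evalE -det_map_mx map_mxB map_mx1 map_mxM.
have -> : map_mx (horner_eval 0) P = 0 :> 'M[int]_n.
  by apply/matrixP => i j; rewrite !mxE /= horner_evalE P0.
by rewrite mul0mx subr0 det1.
Qed.

(** * Bases and dimension *)

Section Bases.
Variables (K : fieldType) (V : lmodType K).

(** Otherwise the matrix of coordinates of [v] in terms of [b] has more rows
    than columns, and a vector in its left kernel is a linear dependence. *)
Lemma free_le_span (m n : nat) (v : 'I_m -> V) (b : 'I_n -> V) :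
  (forall c : 'I_m -> K, \sum_i c i *: v i = 0 -> forall i, c i = 0) ->
  (forall i, exists c : 'I_n -> K, v i = \sum_j c j *: b j) -> (m <= n)%N.
Proof.
move=> vfree /boolp.choice[c vE]; pose A := \matrix_(i, j) c i j.
suff /eqP <- : row_free A by apply: rank_leq_col.
rewrite -kermx_eq0; apply/rowV0P => u /sub_kermxP uA.
apply/rowP => i; rewrite mxE; apply: (vfree (fun i => u 0 i)) => {i}.
rewrite (eq_bigr (fun i => \sum_j (u 0 i * c i j) *: b j)); last first.
  by move=> i _; rewrite vE scaler_sumr; apply: eq_bigr => j _; rewrite scalerA.
rewrite exchange_big big1 //= => j _; rewrite -scaler_suml.
have /rowP/(_ j) := uA; rewrite !mxE => uAj.
rewrite [X in X *: _](_ : _ = 0) ?scale0r // -[RHS]uAj.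
by apply: eq_bigr => k _; rewrite mxE.
Qed.

Lemma dimE (W : set V) (n : nat) (b : 'I_n -> V) : is_basis W b -> Defs.dim W = n.
Proof.
move=> bW; apply: xget_unique; first by exists b.
move=> m [b' [b'W b'free b'span]]; have [bW' bfree bspan] := bW.
apply/eqP; rewrite eqn_leq.
rewrite (free_le_span b'free (fun i => bspan _ (b'W i))).
by rewrite (free_le_span bfree (fun i => b'span _ (bW' i))).
Qed.

End Bases.

(** * Normal forms of paths modulo an ideal *)

(** Linear extension of a partial map on paths, undefined values counting as
    zero.  Locked, as unification unfolds finitely supported functions. *)
HB.lock Definition path_lin (K : fieldType) (Q : quiver)
    (f : qpath Q -> option (qpath Q)) (x : path_algebra K Q) : path_algebra K Q :=
  \sum_(p <- msupp x) x@_p *: opathE K (f p).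

(** The data of an ideal spanned by the dead paths and by the differences of
    paths with the same key: a class of parallel paths becomes one basis
    element of the quotient, or zero.  The fields [key_cat], [dead_catl] and
    [dead_catr] make this span a two-sided ideal; [key_start], [key_end] and
    [key_len] make the quotient graded by the end points and by the length. *)
Record path_congruence (Q : quiver) (B : eqType) (key : qpath Q -> B)
    (dead : pred (qpath Q)) : Prop := PathCongruence {
  key_start : forall p q, key p = key q -> pstart p = pstart q;
  key_end : forall p q, key p = key q -> pend p = pend q;
  key_len : forall p q, key p = key q -> plen p = plen q;
  key_dead : forall p q, key p = key q -> dead p = dead q;
  key_cat : forall p p' q q' r r', key p = key p' -> key q = key q' ->
    pcat p q = Some r -> pcat p' q' = Some r' -> key r = key r';
  dead_catl : forall p q r, dead p -> pcat p q = Some r -> dead r;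
  dead_catr : forall p q r, dead q -> pcat p q = Some r -> dead r }.

Section NormalForms.
Variables (K : fieldType) (Q : quiver) (B : eqType) (key : qpath Q -> B).
Variable dead : pred (qpath Q).
Hypothesis C : path_congruence key dead.
Local Notation KQ := (path_algebra K Q).
Implicit Types (p q r : qpath Q) (x y : KQ).

(** As [choose] depends on the predicate only, all live paths with the same key
    have the same normal form. *)
Definition nf p : option (qpath Q) :=
  if dead p then None else Some (choose (fun r => key r == key p) p).

Definition normal p := nf p == Some p.

Lemma nf_key p q : key p = key q -> nf p = nf q.
Proof.
move=> E; rewrite /nf (key_dead C E); case: ifP => // _; congr Some.
rewrite (@eq_choose _ _ (fun r => key r == key q)) => [|r]; last by rewrite E.
by apply: choose_id => /=; rewrite ?E.
Qed.

Lemma key_nf p q : nf p = Some q -> key q = key p.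
Proof.
rewrite /nf; case: ifP => // _ [<-]; apply/eqP.
exact: (@chooseP _ (fun r => key r == key p)).
Qed.

Lemma nf_normal p q : nf p = Some q -> normal q.
Proof. by move=> E; rewrite /normal (nf_key (key_nf E)) E. Qed.

Local Notation red := (@path_lin K Q nf).

Lemma redw (d : {fset qpath Q}) x : (msupp x `<=` d)%fset ->
  red x = \sum_(p <- d) x@_p *: opathE K (nf p).
Proof.
move=> le; rewrite unlock; apply: (big_fset_incl _ le) => p _ /mcoeff_outdom ->.
by rewrite scale0r.
Qed.

Lemma redD x y : red (x + y) = red x + red y.
Proof.
rewrite (redw (msuppD_le x y)) (redw (fsubsetUl _ (msupp y))).
rewrite (redw (fsubsetUr (msupp x) _)) -big_split; apply/eq_bigr => p _.
by rewrite mcoeffD scalerDl.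
Qed.

Lemma redZ c x : red (c *: x) = c *: red x.
Proof.
rewrite (redw (msuppZ_le c x)) (redw (fsubset_refl (msupp x))) scaler_sumr.
apply/eq_bigr => p _.
by rewrite mcoeffZ scalerA.
Qed.

Lemma red0 : red 0 = 0.
Proof. by apply: (addrI (red 0)); rewrite -redD !addr0. Qed.

Lemma redN x : red (- x) = - red x.
Proof. by rewrite -scaleN1r redZ scaleN1r. Qed.

Lemma red_path p : red (pathE K p) = opathE K (nf p).
Proof.
have sE : (msupp (pathE K p) `<=` [fset p])%fset by rewrite unlock msuppU_le.
by rewrite (redw sE) big_seq_fset1 pathE.unlock mcoeffUU scale1r.
Qed.

Lemma red_opath o : red (opathE K o) = opathE K (obind nf o).
Proof. by case: o => [p|] /=; [exact: red_path | exact: red0]. Qed.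

Lemma red_idem x : red (red x) = red x.
Proof.
elim/pa_ind: x => [|x y IH IH'|c x IH|p].
- by rewrite !red0.
- by rewrite !redD IH IH'.
- by rewrite !redZ IH.
rewrite red_path red_opath; congr opathE; case E: (nf p) => [q|] //=.
exact/eqP/(nf_normal E).
Qed.

Lemma pcat_nf p p' q q' : key p = key p' -> key q = key q' ->
  obind nf (pcat p q) = obind nf (pcat p' q').
Proof.
move=> Ep Eq; have [e|ne] := eqVneq (pend p) (pstart q); last first.
  have ne' : pend p' <> pstart q'.
    by rewrite -(key_end C Ep) -(key_start C Eq); apply/eqP.
  by rewrite (pcat_none (elimN eqP ne : pend p <> pstart q)) pcat_none.
have e' : pend p' = pstart q' by rewrite -(key_end C Ep) -(key_start C Eq).
have [r Er _] := pcatP e; have [r' Er' _] := pcatP e'.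
by rewrite Er Er' /=; apply/nf_key/(key_cat C Ep Eq Er Er').
Qed.

(** Reduction may be applied to a factor before it is applied to a product; thus
    a product with a factor that reduces to zero reduces to zero. *)
Lemma red_mull p x : red (pathE K p * red x) = red (pathE K p * x).
Proof.
elim/pa_ind: x => [|x y IH IH'|c x IH|q].
- by rewrite !red0 !mulr0 red0.
- by rewrite redD !mulrDr !redD IH IH'.
- have E y : red (pathE K p * (c *: y)) = c *: red (pathE K p * y).
    by rewrite -(pa_scaleAr c (pathE K p) y); apply: redZ.
  by rewrite (E x) -IH -(E (red x)) -(redZ c x).
rewrite red_path pathEM red_opath; case E: (nf q) => [q'|] /=.
  by rewrite pathEM red_opath (pcat_nf erefl (key_nf E)).
have dq : dead q by move: E; rewrite /nf; case: (dead q).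
rewrite mulr0 red0; case F: (pcat p q) => [r|] //=.
by rewrite /nf (dead_catr C dq F).
Qed.

Lemma red_mulr p x : red (red x * pathE K p) = red (x * pathE K p).
Proof.
elim/pa_ind: x => [|x y IH IH'|c x IH|q].
- by rewrite !red0 !mul0r red0.
- by rewrite redD !mulrDl !redD IH IH'.
- have E y : red ((c *: y) * pathE K p) = c *: red (y * pathE K p).
    by rewrite -(pa_scaleAl c y); apply: redZ.
  by rewrite (E x) -IH -(E (red x)) -(redZ c x).
rewrite red_path pathEM red_opath; case E: (nf q) => [q'|] /=.
  by rewrite pathEM red_opath (pcat_nf (key_nf E) erefl).
have dq : dead q by move: E; rewrite /nf; case: (dead q).
rewrite mul0r red0; case F: (pcat q p) => [r|] //=.
by rewrite /nf (dead_catl C dq F).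
Qed.

Lemma red_ideal : two_sided_ideal [set x | red x = 0]%classic.
Proof.
split=> [|x y /= x0 y0|a x /= x0|a x /= x0]; first exact: red0.
- by rewrite redD redN x0 y0 subr0.
- elim/pa_ind: a => [|a b IH IH'|c a IH|p].
  + by rewrite mul0r red0.
  + by rewrite mulrDl redD IH IH' addr0.
  + by rewrite -(pa_scaleAl c a x) redZ IH scaler0.
  + by rewrite -red_mull x0 mulr0 red0.
- elim/pa_ind: a => [|a b IH IH'|c a IH|p].
  + by rewrite mulr0 red0.
  + by rewrite mulrDr redD IH IH' addr0.
  + by rewrite -(pa_scaleAr c x a) redZ IH scaler0.
  + by rewrite -red_mulr x0 mul0r red0.
Qed.

Variable J : ideal KQ.


(** [J] lies in the kernel of the reduction since this kernel is a two-sided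
    ideal containing the generators.  Conversely [x - red x] lies in [J], as it
    does when [x] is a path. *)
Lemma ideal_red (G : set KQ) :
  (forall x, J x -> gen_ideal G x) -> (forall g, G g -> red g = 0) ->
  (forall p, dead p -> J (pathE K p)) ->
  (forall p q, key p = key q -> J (pathE K p - pathE K q)) ->
  forall x, J x <-> red x = 0.
Proof.
move=> JG G0 Jdead Jkey; have [J0 JB JMl JMr] := idealP J.
have JZ c x : J x -> J (c *: x).
  by move=> Jx; rewrite -[x]mul1r pa_scaleAl; apply: JMl.
have Jred x : J (x - red x).
  elim/pa_ind: x => [|x y IH IH'|c x IH|p].
  - by rewrite red0 subr0.
  - by rewrite redD opprD addrACA; apply: idealD.
  - by rewrite redZ -scalerBr; apply: JZ.
  rewrite red_path; case E: (nf p) => [q|] /=.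
    by apply/Jkey; rewrite (key_nf E).
  by rewrite subr0; apply: Jdead; move: E; rewrite /nf; case: (dead p).
move=> x; split=> [/JG xG|x0]; last by have := Jred x; rewrite x0 subr0.
by apply: (xG [set x | red x = 0]%classic); split; [exact: red_ideal | exact: G0].
Qed.

Hypothesis JE : forall x, J x <-> red x = 0.
Local Notation A := (quotient_algebra J).
Local Notation cls p := (qpi J (pathE K p)).

(** As [J] is the kernel of the reduction, an element and its reduction have the
    same class; so the classes of normal paths span the quotient, and they are
    independent by [normal_free]. *)
Lemma qpi_red x : qpi J (red x) = qpi J x.
Proof. by apply/qpiP/JE; rewrite redD redN red_idem subrr. Qed.

Lemma qpi0 : qpi J 0 = 0.
Proof. by apply: (addrI (qpi J 0)); rewrite -qpiD !addr0. Qed.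

Lemma qpi_sum (T : Type) (s : seq T) (F : T -> KQ) :
  qpi J (\sum_(i <- s) F i) = \sum_(i <- s) qpi J (F i).
Proof. exact: (big_morph _ (qpiD J) qpi0). Qed.

Lemma red_normal_comb (T : Type) (s : seq T) (c : T -> K) (v : T -> qpath Q) :
  (forall i, normal (v i)) ->
  red (\sum_(i <- s) c i *: pathE K (v i)) = \sum_(i <- s) c i *: pathE K (v i).
Proof.
move=> vN; rewrite (big_morph _ redD red0); apply: eq_bigr => i _.
by rewrite redZ red_path (eqP (vN i)).
Qed.

Lemma mcoeff_comb (T : Type) (s : seq T) (c : T -> K) (v : T -> qpath Q) q :
  (\sum_(i <- s) c i *: pathE K (v i))@_q = \sum_(i <- s) c i * (v i == q)%:R.
Proof.
rewrite (big_morph (mcoeff q) (mcoeffD q) (mcoeff0 q)).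
by apply: eq_bigr => i _; rewrite mcoeffZ unlock mcoeffU -mulr_natr mul1r.
Qed.

Lemma normal_free m (v : 'I_m -> qpath Q) :
  injective v -> (forall i, normal (v i)) ->
  forall c : 'I_m -> K, \sum_i c i *: cls (v i) = 0 -> forall i, c i = 0.
Proof.
move=> vI vN c c0 i; pose x := \sum_i c i *: pathE K (v i).
have x0 : x = 0.
  suff /JE : J x by rewrite /x red_normal_comb.
  rewrite -[x]subr0; apply/qpiP.
  by rewrite qpi0 -c0 qpi_sum; apply: eq_bigr => k _; rewrite qpiZ.
have := mcoeff_comb (index_enum 'I_m) c v (v i); rewrite -/x x0 mcoeff0.
rewrite (bigD1 i) //= eqxx mulr1 big1 ?addr0 // => k /negbTE ki.
by rewrite (inj_eq vI) ki mulr0.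
Qed.

Definition nspan (s : seq (qpath Q)) (w : A) :=
  exists c : qpath Q -> K, w = \sum_(p <- s) c p *: cls p.

Lemma dim_normal (W : set A) s : uniq s -> all normal s ->
  (forall w, W w <-> nspan s w) -> Defs.dim W = size s.
Proof.
move=> sU sN WE; pose v i := tnth (in_tuple s) i.
apply: (@dimE K A W (size s) (fun i => cls (v i))); split.
- move=> i; apply/WE; exists (fun p => (p == v i)%:R).
  rewrite (bigD1_seq (v i)) ?mem_tnth //= eqxx scale1r big1 ?addr0 //.
  by move=> p /negbTE ->; rewrite scale0r.
- apply: normal_free => [|i]; first by apply/tuple_uniqP.
  by apply: (allP sN); apply: mem_tnth.
- move=> w /WE[c ->]; exists (fun i => c (v i)).
  by rewrite big_tnth.
Qed.

Lemma idem_path i j p : idem K i * pathE K p * idem K j =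
  if (pstart p == i) && (pend p == j) then pathE K p else 0.
Proof.
rewrite /idem pathEM pcat_triv_l eq_sym; case: (pstart p == i) => /=; last exact: mul0r.
by rewrite pathEM pcat_triv_r eq_sym; case: (pend p == j).
Qed.

(** Multiplying by the idempotents kills exactly the paths with other end points,
    and taking normal forms preserves end points and length.  The predicate [L]
    on lengths serves to treat a whole Peirce component and its part of a given
    degree together. *)
Lemma dim_peirce i j (L : pred nat) (W : set A) s :
  (forall w, W w <-> exists x, (forall p, p \in msupp x -> L (plen p)) /\
     w = qpi J (idem K i * x * idem K j)) ->
  uniq s ->
  (forall p, p \in s = [&& normal p, pstart p == i, pend p == j & L (plen p)]) ->
  Defs.dim W = size s.
Proof.
move=> WE sU sE; apply: dim_normal => //.
  by apply/allP => p; rewrite sE => /and4P[].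
move=> w; rewrite WE; split=> [[x [xL ->]]|[c ->]]; last first.
  exists (\sum_(p <- s) c p *: pathE K p); split.
    move=> p; rewrite -mcoeff_neq0 mcoeff_comb => p0.
    have : p \in s.
      apply: contraNT p0 => ps; rewrite big_seq big1 // => q qs.
      by rewrite (negbTE (memPn ps q qs)) mulr0.
    by rewrite sE => /and4P[].
  rewrite mulr_sumr mulr_suml qpi_sum big_seq [RHS]big_seq; apply: eq_bigr => p.
  rewrite sE => /and4P[_ pi pj _].
  by rewrite -pa_scaleAr -pa_scaleAl idem_path pi pj qpiZ.
rewrite [x]pathE_sum mulr_sumr mulr_suml qpi_sum big_seq.
have span0 : nspan s 0.
  by exists (fun _ => 0); rewrite big1 // => q _; rewrite scale0r.
apply: (big_ind (nspan s)) => // [u v [c ->] [d ->]|p /xL pL].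
  exists (fun p => c p + d p); rewrite -big_split; apply: eq_bigr => p _.
  by rewrite scalerDl.
rewrite -pa_scaleAr -pa_scaleAl idem_path; case: ifP => [/andP[pi pj]|_]; last first.
  by rewrite scaler0 qpi0.
rewrite qpiZ -qpi_red red_path; case E: (nf p) => [q|] /=; last by rewrite qpi0 scaler0.
have qs : q \in s.
  by rewrite sE (nf_normal E) (key_start C (key_nf E)) (key_end C (key_nf E))
             (key_len C (key_nf E)) pi pj.
exists (fun r => x@_p * (r == q)%:R); rewrite (bigD1_seq q) //= eqxx mulr1.
by rewrite big1 ?addr0 // => r /negbTE ->; rewrite mulr0 scale0r.
Qed.

Lemma peirceP i j w : @peirce K Q J i j w <->
  exists x, (forall p, p \in msupp x -> predT (plen p)) /\
     w = qpi J (idem K i * x * idem K j).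
Proof.
split=> [[a _ <-]|[x [_ ->]]]; first by exists (qrepr a); rewrite !qpiM qreprK.
by exists (qpi J x); rewrite ?qpiM.
Qed.

Lemma peirce_partP i j n w : @peirce_part K Q J i j n w <->
  exists x, (forall p, p \in msupp x -> plen p == n) /\
     w = qpi J (idem K i * x * idem K j).
Proof.
split=> [[a [x xn <-] <-]|[x [xn ->]]].
  by exists x; rewrite !qpiM; split=> // p /xn ->.
by exists (qpi J x); rewrite ?qpiM //; exists x => // p /xn /eqP.
Qed.

End NormalForms.

(** * Generating functions of walks *)

Section FinMatrices.
Variable R : comPzRingType.

(** Matrices are indexed by finite types through the enumeration that is also
    used for Cartan matrices. *)
Definition fmx (T U : finType) (f : T -> U -> R) : 'M[R]_(#|T|, #|U|) :=
  \matrix_(i, j) f (enum_val i) (enum_val j).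

Lemma big_enum_ord (T : finType) (F : T -> R) :
  \sum_(a : T) F a = \sum_(i < #|T|) F (enum_val i).
Proof. by rewrite (reindex _ (onW_bij _ (@enum_val_bij T))). Qed.

Lemma eq_fmx (T U : finType) (f g : T -> U -> R) :
  (forall a b, f a b = g a b) -> fmx f = fmx g.
Proof. by move=> fg; apply/matrixP => i j; rewrite !mxE fg. Qed.

Lemma fmxM (T U V : finType) (f : T -> U -> R) (g : U -> V -> R) :
  fmx f *m fmx g = fmx (fun a c => \sum_b f a b * g b c).
Proof.
apply/matrixP => i j; rewrite !mxE [RHS]big_enum_ord.
by apply: eq_bigr => k _; rewrite !mxE.
Qed.

Lemma fmxD (T U : finType) (f g : T -> U -> R) :
  fmx f + fmx g = fmx (fun a b => f a b + g a b).
Proof. by apply/matrixP => i j; rewrite !mxE. Qed.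

Lemma fmxZ (T U : finType) c (f : T -> U -> R) :
  c *: fmx f = fmx (fun a b => c * f a b).
Proof. by apply/matrixP => i j; rewrite !mxE. Qed.

Lemma fmx1 (T : finType) : fmx (fun a b : T => (a == b)%:R) = 1%:M.
Proof. by apply/matrixP => i j; rewrite !mxE (inj_eq enum_val_inj). Qed.

End FinMatrices.

Lemma uniq_flatten_tag (I T : eqType) (E : I -> seq T) (tag : T -> I) (s : seq I) :
  uniq s -> (forall i, uniq (E i)) -> (forall i x, x \in E i -> tag x = i) ->
  uniq (flatten [seq E i | i <- s]).
Proof.
move=> + EU Etag; elim: s => //= i s IH /andP[is_ /IH us].
rewrite cat_uniq EU us andbT; apply/hasPn => x /flatten_mapP[j js xj].
by apply: contraNN is_ => /Etag <-; rewrite (Etag _ _ xj).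
Qed.

Section Walks.
Variables (T : finType) (e : rel T).

(** Listing walks by their first step makes the recursion for their number
    immediate; [walk_count n a b] is the entry of the [n]-th power of the adjacency
    matrix of [e]. *)
Fixpoint walks_from n a : seq (seq T) :=
  if n is m.+1 then
    flatten [seq [seq b :: w | w <- walks_from m b] | b <- enum T & e a b]
  else [:: [::]].

Lemma mem_walks_from n a w : (w \in walks_from n a) = path e a w && (size w == n).
Proof.
elim: n a w => [|n IH] a [|b w] //=; first by rewrite inE andbF.
  by apply/negbTE/negP => /flatten_mapP[b _ /mapP[]].
rewrite eqSS -andbA -IH; apply/flatten_mapP/andP.
  by move=> [c]; rewrite mem_filter => /andP[ac _] /mapP[v vc [-> ->]].
by move=> [ab wb]; exists b; [rewrite mem_filter ab mem_enum | exact: map_f].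
Qed.

Lemma walks_from_uniq n a : uniq (walks_from n a).
Proof.
elim: n a => //= n IH a; apply: (uniq_flatten_tag (tag := head a)).
- exact/filter_uniq/enum_uniq.
- by move=> b; rewrite map_inj_uniq ?IH // => w w' [].
- by move=> b w /mapP[v _ ->].
Qed.

Definition walk_count n a b := count (fun w => last a w == b) (walks_from n a).

Lemma walk_count0 a b : walk_count 0 a b = (a == b).
Proof. by rewrite /walk_count /= addn0. Qed.

Lemma walk_countS n a b : walk_count n.+1 a b = (\sum_c e a c * walk_count n c b)%N.
Proof.
rewrite /walk_count /= count_flatten -map_comp sumnE big_map big_filter big_enum_cond.
rewrite big_mkcond; apply: eq_bigr => c _ /=.
by rewrite count_map; case: (e a c); rewrite ?mul1n ?mul0n.
Qed.

Variable m : nat.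
Hypothesis bounded : forall a w, path e a w -> (size w < m)%N.

Lemma walk_count_eq0 n a b : (m <= n)%N -> walk_count n a b = 0%N.
Proof.
move=> mn; rewrite /walk_count; case E: (walks_from n a) => [//|w s].
have : w \in walks_from n a by rewrite E inE eqxx.
rewrite mem_walks_from => /andP[/bounded + /eqP wn].
by rewrite wn ltnNge mn.
Qed.

(** The entries of the sum of the powers of [q T], where [T] is the adjacency
    matrix of [e].  All walks are shorter than [m], so the truncation loses
    nothing. *)
Definition walk_poly a b : {poly int} := \poly_(n < m) (walk_count n a b)%:R.

Lemma coef_walk_poly a b n : (walk_poly a b)`_n = (walk_count n a b)%:R.
Proof. by rewrite coef_poly; case: ltnP => // /walk_count_eq0 ->. Qed.

(** The geometric series [G] of [q T] satisfies [G = 1 + q T G]. *)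
Lemma walk_polyE : fmx walk_poly =
  1%:M + fmx (fun a b => 'X * (e a b)%:R) *m fmx walk_poly.
Proof.
rewrite fmxM -fmx1 fmxD; apply: eq_fmx => a b; apply/polyP => n.
rewrite coef_walk_poly coefD coef_sum.
have cE c : ('X * (e a c)%:R * walk_poly c b)`_n =
    if n is k.+1 then (e a c)%:R * (walk_count k c b)%:R else 0.
  case: (e a c); rewrite ?mulr1 ?mulr0 ?mul0r ?coef0; last first.
    by case: (n) => // k; rewrite mul0r.
  by rewrite coefXM; case: (n) => //= k; rewrite coef_walk_poly mul1r.
rewrite (eq_bigr _ (fun c _ => cE c)) -[in RHS](rmorph_nat polyC) coefC.
case: (n) => [|k] /=; first by rewrite big1_eq walk_count0 addr0.
by rewrite add0r walk_countS natr_sum; apply: eq_bigr => c _; rewrite natrM.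
Qed.
End Walks.

(** * Splitting paths at special vertices *)

Section CartanDeterminant.
Variables (Q : quiver) (Sp : {set Q}) (e e' : rel (arrow Q)) (m : nat).
Hypothesis bounded : forall a w, path e a w -> (size w < m)%N.
Hypothesis bounded' : forall a w, path e' a w -> (size w < m)%N.
Hypothesis e'E : forall a b,
  e' a b = (e a b + ((tgt a == src b) && (src b \in Sp)))%N :> nat.

(** Walks along the arrows with consecutive arrows related by [r] are paths in
    [Q].  The factor ['X] is there because a walk with [n] steps runs through
    [n + 1] arrows; in particular trivial paths are not counted. *)
Definition path_poly (r : rel (arrow Q)) i j : {poly int} :=
  'X * \sum_(a | src a == i) \sum_(b | tgt b == j) walk_poly r m a b.

Let srcM : 'M[{poly int}]_(#|Q|, #|arrow Q|) := fmx (fun i a => (src a == i)%:R).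
Let tgtM : 'M[{poly int}]_(#|arrow Q|, #|Q|) := fmx (fun a j => (tgt a == j)%:R).
Let spM : 'M[{poly int}]_#|Q| := fmx (fun i j => ((i == j) && (i \in Sp))%:R).

Lemma path_polyE r : fmx (path_poly r) = 'X *: (srcM *m fmx (walk_poly r m) *m tgtM).
Proof.
rewrite !fmxM fmxZ; apply: eq_fmx => i j; rewrite /path_poly; congr (_ * _).
under [RHS]eq_bigr do rewrite mulr_suml.
rewrite [RHS]exchange_big [LHS]big_mkcond; apply: eq_bigr => a _ /=.
case: (src a == i); last by rewrite big1 // => b _; rewrite !mul0r.
rewrite big_mkcond; apply: eq_bigr => b _; rewrite mul1r.
by case: ifP; rewrite ?mulr1 ?mulr0.
Qed.

(** The relation [e'] differs from [e] by the passages through special vertices,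
    and such a passage factors through its vertex. *)
Lemma transferE : fmx (fun a b => 'X * (e' a b)%:R) =
  fmx (fun a b => 'X * (e a b)%:R) + 'X *: (tgtM *m spM *m srcM).
Proof.
rewrite !fmxM fmxZ fmxD; apply: eq_fmx => a b.
rewrite e'E natrD mulrDr; congr (_ + _ * _).
rewrite (bigD1 (src b)) //= eqxx mulr1 [X in _ + X]big1 ?addr0; last first.
  by move=> i /negbTE ib; rewrite eq_sym ib mulr0.
rewrite (bigD1 (src b)) //= eqxx [X in _ + X]big1 ?addr0; last first.
  by move=> i /negbTE ib; rewrite ib mulr0.
by rewrite -natrM mulnb.
Qed.

(** An [e']-path is an [e]-path, or it consists of the [e]-path up to its first
    passage through a special vertex and of a nontrivial [e']-path from there.
    In terms of the geometric series [G] and [G'] this is the resolvent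
    identity [G' = G + G (q T' - q T) G']. *)
Lemma path_poly_split : fmx (path_poly e') =
  fmx (path_poly e) + fmx (path_poly e) *m spM *m fmx (path_poly e').
Proof.
rewrite !path_polyE.
set g := fmx (walk_poly e m); set g' := fmx (walk_poly e' m).
set T := fmx (fun a b => 'X * (e a b)%:R) : 'M[{poly int}]_#|arrow Q|.
have g1 : (1%:M - T) *m g = 1%:M.
  by rewrite mulmxBl mul1mx {1}[g](walk_polyE bounded) addrK.
have g'1 : g' = 1%:M + (T + 'X *: (tgtM *m spM *m srcM)) *m g'.
  by rewrite -transferE -walk_polyE.
have gE : g' = g + 'X *: (g *m tgtM *m spM *m srcM *m g').
  rewrite -[LHS]mul1mx -(mulmx1C g1) -mulmxA mulmxBl mul1mx {1}g'1 mulmxDl addrA.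
  rewrite [1%:M + _ + _]addrAC addrK mulmxDr mulmx1.
  by rewrite -scalemxAl -scalemxAr !mulmxA.
rewrite {1}gE mulmxDr mulmxDl scalerDr; congr (_ + _).
by rewrite -!scalemxAl -!scalemxAr -?scalemxAl !mulmxA.
Qed.

(** Let [u] be the incidence matrix of [under], so that the matrix on the left is
    [1 + u N u^T], with [N] the matrix of [path_poly e'].  Its determinant is
    [det (1 + N u^T u)], and [u^T u] is diagonal with the sizes of the fibres,
    [2] at special vertices and [1] elsewhere. *)
Lemma det_path_poly (H : finType) (under : H -> Q) :
  (forall i, #|[pred x | under x == i]| = (i \in Sp).+1) ->
  \det (fmx (fun x y => (x == y)%:R + path_poly e' (under x) (under y))) =
  \det (fmx (fun i j => (i == j)%:R + path_poly e i j)).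
Proof.
move=> fib; rewrite -!fmxD !fmx1.
pose u : 'M[{poly int}]_(#|H|, #|Q|) := fmx (fun x i => (under x == i)%:R).
pose v : 'M[{poly int}]_(#|Q|, #|H|) := fmx (fun i x => (under x == i)%:R).
have -> : fmx (fun x y => path_poly e' (under x) (under y)) =
    u *m (fmx (path_poly e') *m v).
  rewrite !fmxM; apply: eq_fmx => x y.
  rewrite (bigD1 (under x)) //= eqxx mul1r [X in _ + X]big1 ?addr0; last first.
    by move=> i /negbTE ix; rewrite eq_sym ix mul0r.
  rewrite (bigD1 (under y)) //= eqxx mulr1 [X in _ + X]big1 ?addr0 //.
  by move=> i /negbTE iy; rewrite eq_sym iy mulr0.
rewrite det_one_addC -mulmxA.
have -> : v *m u = 1%:M + spM.
  rewrite fmxM -fmx1 fmxD; apply: eq_fmx => i j.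
  have [->|ij] := eqVneq i j; last first.
    rewrite addr0 big1 // => x _; case: (under x =P i) => [->|]; last by rewrite mul0r.
    by rewrite (negbTE ij) mulr0.
  rewrite /= -mulrS -fib -sum1_card natr_sum [RHS]big_mkcond /=.
  by apply: eq_bigr => x _; rewrite inE; case: eqP; rewrite ?mulr0 ?mulr1.
apply: det_resolvent_X; first exact: path_poly_split.
by move=> i j; rewrite mxE hornerM hornerX mul0r.
Qed.

End CartanDeterminant.

(** * Cartan matrices count normal paths *)

Section PathLemmas.
Variable (K : fieldType) (Q : quiver).
Implicit Types (p q r : qpath Q) (a b : arrow Q).

Lemma qpath_eq p q : pstart p = pstart q -> parrows p = parrows q -> p = q.
Proof.
move=> E1 E2; apply: val_inj; rewrite [LHS]surjective_pairing [RHS]surjective_pairing.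
by congr pair.
Qed.

Lemma walk_cons (v : Q) a s : walk v (a :: s) = (src a == v) && walk (tgt a) s.
Proof. by []. Qed.

Lemma walk_end_cons (v : Q) a s : walk_end v (a :: s) = walk_end (tgt a) s.
Proof. by []. Qed.

Lemma qpath_of v s : walk v s -> exists2 p : qpath Q, pstart p = v & parrows p = s.
Proof. by move=> vs; exists (exist (fun p : Q * _ => walk p.1 p.2) (v, s) vs). Qed.

Lemma qpath_walk p : walk (pstart p) (parrows p).
Proof. exact: (valP p). Qed.

Lemma pathE_cons p a s : parrows p = a :: s ->
  exists q, [/\ pathE K p = arr K a * pathE K q, pstart p = src a,
                pstart q = tgt a & parrows q = s].
Proof.
move=> ps; have := qpath_walk p; rewrite ps /= => /andP[/eqP pa /qpath_of[q qa qs]].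
exists q; split=> //; rewrite /arr pathEM.
have [r -> rE] := @pcatP Q (arrow_path a) q (esym qa).
by congr pathE; apply: qpath_eq; rewrite /pstart /parrows rE //= -/(parrows q) ?qs.
Qed.

Lemma arr_mul a b : tgt a = src b ->
  exists2 p, arr K a * arr K b = pathE K p & pstart p = src a /\ parrows p = [:: a; b].
Proof.
move=> ab; rewrite /arr pathEM.
have [r -> rE] := @pcatP Q (arrow_path a) (arrow_path b) ab.
by exists r; rewrite // /pstart /parrows rE.
Qed.

Lemma opathE_eq0 o : opathE K o = 0 :> path_algebra K Q -> o = None.
Proof.
case: o => //= p p0; have := mcoeff0 p : (0 : path_algebra K Q)@_p = 0.
by rewrite -p0 unlock mcoeffUU => /eqP; rewrite oner_eq0.
Qed.

Lemma pcat_some p q r : pcat p q = Some r ->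
  [/\ pend p = pstart q, pstart r = pstart p, pend r = pend q &
      parrows r = parrows p ++ parrows q].
Proof.
have [e|ne] := eqVneq (pend p) (pstart q); last by rewrite pcat_none //; apply/eqP.
have [u -> uE] := pcatP e; move=> [<-]; rewrite /pend /pstart /parrows uE; split=> //=.
by rewrite walk_end_cat -/(pend p) e.
Qed.

Lemma walk_end_last i a w : walk_end i (a :: w) = tgt (last a w).
Proof. by rewrite /walk_end /= last_map. Qed.

End PathLemmas.

Section CartanEntry.
Variables (K : fieldType) (Q : quiver) (B : eqType) (key : qpath Q -> B).
Variable dead : pred (qpath Q).
Hypothesis C : path_congruence key dead.
Variable J : ideal (path_algebra K Q).
Hypothesis JE : forall x, J x <-> path_lin (nf key dead) x = 0.

(** The lists [W n] index the normal paths of length [n] from [i] to [j] by means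
    of [f]; the left inverse [g] of [f] shows that this indexing is bijective. *)
Lemma cartan_entry i j (T : eqType) (W : nat -> seq T) (f : T -> qpath Q)
    (g : qpath Q -> T) (c : {poly int}) :
  (forall n, uniq (W n)) ->
  (forall n w, w \in W n ->
     [/\ normal key dead (f w), pstart (f w) = i, pend (f w) = j,
         plen (f w) = n & g (f w) = w]) ->
  (forall p, normal key dead p -> pstart p = i -> pend p = j ->
     g p \in W (plen p) /\ f (g p) = p) ->
  (forall n, c`_n = (size (W n))%:Z) ->
  qcartan_entry J i j = c /\ (Defs.dim (@peirce K Q J i j))%:Z = c.[1].
Proof.
move=> WU Wf gW cE; pose E n := map f (W n).
have EU n : uniq (E n).
  rewrite map_inj_in_uniq // => w w' /Wf[_ _ _ _ {2}<-] /Wf[_ _ _ _ {2}<-].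
  by move=> ->.
have EE n p : p \in E n =
    [&& normal key dead p, pstart p == i, pend p == j & plen p == n].
  apply/mapP/and4P => [[w /Wf[Nw si ej ln _] ->]|[Np /eqP si /eqP ej /eqP <-]].
    by split=> //; apply/eqP.
  by have [gp fgp] := gW _ Np si ej; exists (g p).
have dimE n : Defs.dim (@peirce_part K Q J i j n) = size (W n).
  rewrite -(size_map f) -/(E n).
  apply: (dim_peirce C JE (i := i) (j := j) (L := pred1 n)) (EE n) => //.
  exact: peirce_partP.
split.
  apply: xget_unique => [n|d dE]; first by rewrite dimE.
  by apply/polyP => n; rewrite cE dE dimE.
rewrite (dim_peirce C JE (i := i) (j := j) (L := predT)
  (s := flatten [seq E n | n <- index_iota 0 (size c)])).
- rewrite size_flatten /shape sumnE !big_map big_mkord.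
  rewrite horner_coef -natz natr_sum; apply: eq_bigr => n _.
  by rewrite expr1n mulr1 cE size_map natz.
- exact: peirceP.
- apply: (uniq_flatten_tag (tag := @plen Q)) => // [|n p]; first exact: iota_uniq.
  by rewrite EE => /and4P[_ _ _ /eqP].
move=> p; apply/flatten_mapP/and4P => [[n _]|[Np si ej _]].
  by rewrite EE => /and4P[].
have pE : p \in E (plen p) by rewrite EE Np si ej /=.
exists (plen p) => //; rewrite mem_index_iota /= ltnNge; apply/negP => /(nth_default 0).
rewrite cE => -[] /size0nil W0; move: pE; by rewrite /E W0.
Qed.

End CartanEntry.

Section WalkLists.
Variables (Q : quiver) (e : rel (arrow Q)).

(** The arrow sequences of the paths from [i] to [j] of length [n] with consecutive
    arrows related by [e].  The flag [d] says whether there is a trivial path;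
    it is separate from [i] and [j] since two distinct vertices over the same
    special vertex are joined by no trivial path. *)
Definition walk_seqs (d : bool) (i j : Q) n : seq (seq (arrow Q)) :=
  if n is k.+1 then
    flatten [seq [seq a :: w | w <- walks_from e k a & tgt (last a w) == j]
            | a <- enum (arrow Q) & src a == i]
  else nseq d [::].

Lemma mem_walk_seqs d i j n s : (s \in walk_seqs d i j n) = (size s == n) &&
  (if s is a :: w then [&& src a == i, path e a w & tgt (last a w) == j] else d).
Proof.
case: n => [|n]; first by case: s => [|a w]; case: d.
apply/flatten_mapP/idP => [[a]|].
  rewrite mem_filter => /andP[ai _] /mapP[w].
  by rewrite mem_filter mem_walks_from => /and3P[wj aw wn] ->; rewrite /= eqSS wn ai aw.
case: s => [|a w] //; rewrite /= eqSS => /and4P[wn ai aw wj].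
exists a; first by rewrite mem_filter ai mem_enum.
by apply: map_f; rewrite mem_filter wj mem_walks_from aw.
Qed.

Lemma walk_seqs_uniq d i j n : uniq (walk_seqs d i j n).
Proof.
case: n => [|n] /=; first by case: d.
case E: (enum (arrow Q)) => [//|a0 s]; rewrite -E {s E}.
apply: (uniq_flatten_tag (tag := head a0)).
- exact/filter_uniq/enum_uniq.
- by move=> a; rewrite map_inj_uniq ?filter_uniq ?walks_from_uniq // => w w' [].
- by move=> a w /mapP[v _ ->].
Qed.

Lemma count_fibers (T U : finType) (S : Type) (f : S -> T) (h : T -> U) u s :
  count (fun x => h (f x) == u) s =
  (\sum_(t | h t == u) count (fun x => f x == t) s)%N.
Proof.
elim: s => [|x s IH] /=; first by rewrite big1_eq.
rewrite big_split -IH /=; congr (_ + _)%N.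
have [hx|hx] := boolP (h (f x) == u).
  rewrite (bigD1 (f x)) //= eqxx big1 // => t /andP[_ /negbTE tx].
  by rewrite eq_sym tx.
rewrite big1 // => t ht; case: eqP => // tx; by rewrite tx ht in hx.
Qed.

Variable m : nat.
Hypothesis bounded : forall a w, path e a w -> (size w < m)%N.

Lemma coef_path_poly (d : bool) i j n :
  (d%:R + path_poly m e i j)`_n = (size (walk_seqs d i j n))%:Z.
Proof.
rewrite coefD -(rmorph_nat polyC) coefC coefXM; case: n => [|n] /=.
  by rewrite addr0 size_nseq natz.
rewrite add0r size_flatten /shape sumnE -map_comp big_map big_filter -natz natr_sum.
rewrite big_enum_cond coef_sum; apply: eq_bigr => a _ /=.
rewrite size_map size_filter (count_fibers (last a) (@tgt Q)) coef_sum natr_sum.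
by apply: eq_bigr => b _; rewrite coef_walk_poly.
Qed.

End WalkLists.

Lemma walk_sorted (Q : quiver) (r e : rel (arrow Q)) (i : Q) a w :
  (forall a b, e a b = (tgt a == src b) && r a b) ->
  (src a == i) && path e a w = walk i (a :: w) && sorted r (a :: w).
Proof.
move=> eE /=; rewrite -andbA; congr (_ && _).
elim: w a => //= b w IH a; rewrite eE IH [src b == _]eq_sym.
by case: (_ == _); case: (r a b) => //=; rewrite andbF.
Qed.

(** * Ideals generated by paths of length 2 *)

(** For an ideal generated by paths of length 2 the keys are the paths themselves,
    and the dead paths are the paths that contain a zero relation. *)
Section Monomial.
Variables (K : fieldType) (Q : quiver) (J : ideal (path_algebra K Q)).
Variables (Z : rel (arrow Q)) (G : set (path_algebra K Q)).
Let r a b := ~~ Z a b.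
Let dead (p : qpath Q) := ~~ sorted r (parrows p).
Hypothesis JG : forall x, J x -> gen_ideal G x.
Hypothesis Gdead : forall g, G g -> exists2 p, g = pathE K p & dead p.
Hypothesis ZJ : forall a b, Z a b -> tgt a = src b -> J (arr K a * arr K b).
Local Notation nf := (nf id dead).

Lemma id_congruence : path_congruence id dead.
Proof.
split=> //; try by move=> p q ->.
- by move=> p p' q q' s s' -> -> -> [].
- move=> p q s + /pcat_some[_ _ _ E]; rewrite /dead E.
  by apply: contraNN => /cat_sorted2[].
- move=> p q s + /pcat_some[_ _ _ E]; rewrite /dead E.
  by apply: contraNN => /cat_sorted2[].
Qed.

Lemma nf_id p : nf p = if dead p then None else Some p.
Proof.
rewrite /nf; case: ifP => // _; congr Some; apply/eqP.
exact: (@chooseP _ (fun s => s == p)).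
Qed.

Lemma normal_id p : normal id dead p = ~~ dead p.
Proof. by rewrite /normal nf_id; case: (dead p) => //; rewrite eqxx. Qed.

Lemma ideal_dead p : dead p -> J (pathE K p).
Proof.
have [_ _ JMl JMr] := idealP J.
move: {2}(parrows p) (erefl (parrows p)) => s; elim: s p => [|a s IH] p ps.
  by rewrite /dead ps.
have [q [-> pa qa qs]] := pathE_cons K ps; rewrite /dead ps.
case: s qs ps IH => [|b s] // qs ps IH; rewrite [sorted _ _]/= negb_and negbK.
case/orP => [ab|bs]; last by apply/JMl/IH => //; rewrite /dead qs.
have [u [-> qb _ _]] := pathE_cons K qs.
by rewrite mulrA; apply/JMr/ZJ; rewrite // -qa qb.
Qed.

Lemma monomial_ideal x : J x <-> path_lin nf x = 0.
Proof.
apply: (ideal_red id_congruence JG) => [g /Gdead[p -> dp]||p q ->].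
- by rewrite red_path /nf dp.
- exact: ideal_dead.
- by rewrite subrr; case: (idealP J).
Qed.

Lemma monomial_relation a b : tgt a = src b -> J (arr K a * arr K b) -> Z a b.
Proof.
move=> /(arr_mul K)[p -> [_ ps]] /monomial_ideal.
rewrite red_path => /opathE_eq0; rewrite nf_id /dead ps /= andbT negbK.
by case: (Z a b).
Qed.

(** A live path of length [n] has [n + 1] live initial subpaths, and these are
    linearly independent in the quotient. *)
Lemma finite_dim_bound : finite_dim (quotient_algebra J) ->
  exists m, forall p, ~~ dead p -> (plen p < m)%N.
Proof.
move=> [n [b [_ _ bspan]]]; exists n => p pN.
have walk_take k : walk (pstart p) (take k (parrows p)).
  have := qpath_walk p; rewrite -{1}(cat_take_drop k (parrows p)) walk_cat.
  by case/andP.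
pose v k : qpath Q := exist (fun p : Q * _ => walk p.1 p.2) (_, _) (walk_take k).
have vN k : normal id dead (v k).
  rewrite normal_id; move: pN; rewrite /dead !negbK.
  by rewrite -{1}(cat_take_drop k (parrows p)) => /cat_sorted2[].
have vI : injective (fun k : 'I_(plen p).+1 => v k).
  move=> k l kl; apply: val_inj; have := congr1 (@plen Q) kl.
  have tk (i : 'I_(plen p).+1) : plen (v i) = i.
    by rewrite /plen /parrows /= size_takel // -ltnS.
  by rewrite !tk.
apply: (free_le_span (normal_free monomial_ideal vI _)) => [k|k]; first exact: vN.
exact: bspan.
Qed.

Lemma monomial_cartan (e : rel (arrow Q)) m i j :
  (forall a b, e a b = (tgt a == src b) && r a b) ->
  (forall a w, path e a w -> (size w < m)%N) ->
  let c := (i == j)%:R + path_poly m e i j in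
  qcartan_entry J i j = c /\ (Defs.dim (@peirce K Q J i j))%:Z = c.[1].
Proof.
move=> eE bounded c.
pose f w : qpath Q := insubd (triv_path i) (i, w).
have fE w : walk i w -> val (f w) = (i, w).
  by move=> iw; rewrite /f /insubd insubT.
apply: (cartan_entry id_congruence monomial_ideal (W := walk_seqs e (i == j) i j)
  (f := f) (g := @parrows Q)).
- exact: walk_seqs_uniq.
- move=> n w; rewrite mem_walk_seqs => /andP[/eqP <-].
  have wE : walk i w -> sorted r w -> walk_end i w = j ->
      [/\ normal id dead (f w), pstart (f w) = i, pend (f w) = j,
         plen (f w) = size w & parrows (f w) = w].
    move=> iw rw wj; rewrite normal_id /dead negbK /pend /plen /parrows /pstart.
    by rewrite (fE _ iw).
  case: w wE => [|a w] wE; first by move=> /eqP; apply: wE.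
  rewrite andbA (walk_sorted _ _ _ eE) => /andP[/andP[iw rw] /eqP wj].
  by apply: wE => //; rewrite walk_end_last.
- move=> p; rewrite normal_id /dead negbK => pr pi pj.
  have pw := qpath_walk p; rewrite pi in pw; split; last first.
    by apply: qpath_eq; rewrite ?/parrows ?/pstart (fE _ pw) // -/(pstart p) pi.
  rewrite mem_walk_seqs eqxx /=; move: pj; rewrite /pend pi.
  case E: (parrows p) pr pw => [|a w] pr pw; first by move=> <-; rewrite eqxx.
  by rewrite andbA (walk_sorted _ _ _ eE) pw pr walk_end_last => ->; rewrite eqxx.
- by move=> n; apply: coef_path_poly.
Qed.

End Monomial.

(** * Special vertices of a gentle quiver *)

Section Skewed.
Variables (K : fieldType) (Q : quiver) (I : ideal (path_algebra K Q)) (Sp : {set Q}).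
Hypothesis Igentle : gentle I.
Hypothesis Spadm : admissible_special I Sp.

Definition zrel (a b : arrow Q) := `[< zero_relation I a b >].
Definition gentle_step (a b : arrow Q) := (tgt a == src b) && ~~ zrel a b.
(** A passage from an arrow to the next one that does not make the paths of the
    skewed-gentle algebra vanish: at special vertices the zero relations of [I]
    are replaced by commutation relations. *)
Definition hat_pass (a b : arrow Q) := (tgt a \in Sp) || ~~ zrel a b.
Definition hat_step (a b : arrow Q) := (tgt a == src b) && hat_pass a b.

Definition sp_zrel (x y : arrow (sp_quiver Sp)) :=
  match x, y with
  | inl a, inl b => zrel a b
  | inr v, inr w => v == w
  | _, _ => false
  end.

Lemma gentle_presentation : exists G,
  (forall x, I x -> gen_ideal G x) /\
  (forall g, G g -> exists2 p, g = pathE K p &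
     ~~ sorted (fun a b => ~~ zrel a b) (parrows p)).
Proof.
have [P [P2 PE]] := gentle_quadratic Igentle.
exists [set pathE K p | p in P]%classic; split=> [x|g [p Pp <-]]; first by move/PE.
exists p => //; have /PE : gen_ideal [set pathE K p | p in P]%classic (pathE K p).
  by move=> H [_]; apply; exists p.
have := qpath_walk p; have := P2 p Pp; rewrite /plen.
case E: (parrows p) => [|a [|b []]] // _ /= /and3P[pa /eqP ab _] Ip.
rewrite andbT negbK; apply/asboolP; split=> //.
have [q -> [qa qs]] := arr_mul K (esym ab).
rewrite (_ : q = p) //; apply: qpath_eq; last by rewrite qs E.
by rewrite qa (eqP pa).
Qed.

Let spG : set (path_algebra K (sp_quiver Sp)) :=
  ([set x | exists a b, zero_relation I a b /\
        x = arr K (sp_arrow Sp a) * arr K (sp_arrow Sp b)] `|`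
     [set x | exists v, x = arr K (@sp_loop Q Sp v) * arr K (sp_loop v)])%classic.

Lemma sp_gen x : sp_ideal I Sp x -> gen_ideal spG x.
Proof. by []. Qed.

Lemma sp_dead g : spG g ->
  exists2 p, g = pathE K p & ~~ sorted (fun a b => ~~ sp_zrel a b) (parrows p).
Proof.
case=> [[a [b [[ab Iab] ->]]]|[v ->]].
  have [p -> [_ ps]] := @arr_mul K (sp_quiver Sp) (sp_arrow Sp a) (sp_arrow Sp b) ab.
  by exists p; rewrite // ps /= andbT negbK; apply/asboolP.
have [p -> [_ ps]] := @arr_mul K (sp_quiver Sp) (sp_loop v) (sp_loop v) erefl.
by exists p; rewrite // ps /= eqxx.
Qed.

Lemma sp_zrel_ideal x y : sp_zrel x y -> tgt x = src y ->
  sp_ideal I Sp (arr K x * arr K y).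
Proof.
move=> xy _ H [_]; apply; case: x y xy => [a|v] [b|w] //=.
  by move/asboolP => ab; left; exists a, b.
by move=> /eqP ->; right; exists w.
Qed.

Lemma sp_relation x y : tgt x = src y ->
  sp_ideal I Sp (arr K x * arr K y) -> sp_zrel x y.
Proof. exact: (monomial_relation sp_gen sp_dead sp_zrel_ideal). Qed.

(** Both the loop at the special vertex and, if [a b] were nonzero, the arrow [b]
    would continue [a] to a nonzero path, against gentleness of the quiver with
    loops. *)
Lemma special_zero a b : tgt a = src b -> tgt a \in Sp -> zrel a b.
Proof.
move=> ab aS; apply: contraT => nab.
pose v : {v : Q | v \in Sp} := exist _ (tgt a) aS.
have [Ag _] := Spadm.
suff : sp_arrow Sp b = sp_loop v by [].
apply: (gentle_nonzero_r Ag (a := sp_arrow Sp a)).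
  by move/sp_relation => /(_ ab); apply/negP.
by move/sp_relation => /(_ erefl).
Qed.

(** The loop can be preceded by [a] and by [a'] with nonzero products; gentleness
    allows only one of them. *)
Lemma special_in a a' : tgt a \in Sp -> tgt a' = tgt a -> a' = a.
Proof.
move=> aS aa'; pose v : {v : Q | v \in Sp} := exist _ (tgt a) aS.
have [Ag _] := Spadm.
suff [] : sp_arrow Sp a' = sp_arrow Sp a by [].
by apply: (gentle_nonzero_l Ag (a := sp_loop v)) => /sp_relation;
   [move/(_ aa')|move/(_ erefl)].
Qed.

Lemma special_out b b' : src b \in Sp -> src b' = src b -> b' = b.
Proof.
move=> bS bb'; pose v : {v : Q | v \in Sp} := exist _ (src b) bS.
have [Ag _] := Spadm.
suff [] : sp_arrow Sp b' = sp_arrow Sp b by [].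
by apply: (gentle_nonzero_r Ag (a := sp_loop v)) => /sp_relation;
   [move/(_ (esym bb'))|move/(_ erefl)].
Qed.

Lemma special_valency a b : tgt a \in Sp -> tgt a = src b -> valency (tgt a) = 2%N.
Proof.
move=> aS ab; rewrite /valency.
rewrite (_ : [set a' | _] = [set a])%SET; last first.
  apply/setP => a'; rewrite !inE; apply/eqP/eqP => [|-> //]; exact: special_in.
rewrite (_ : [set b' | _] = [set b])%SET ?cards1 //.
apply/setP => b'; rewrite !inE ab; apply/eqP/eqP => [|-> //].
by apply: special_out; rewrite -ab.
Qed.

(** Inserting the loop at every passage through a special vertex removes all zero
    relations, because neither [a] times a loop nor a loop times [b] is zero. *)
Lemma insert_loops a w : path hat_step a w ->
  exists s : seq (arrow (sp_quiver Sp)),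
    [/\ (size w <= size s)%N, walk (tgt a : sp_quiver Sp) s &
        path (fun x y => ~~ sp_zrel x y) (sp_arrow Sp a) s].
Proof.
elim: w a => [|b w IH] a /=; first by exists [::].
move=> /andP[/andP[/eqP ab nz] /IH[s [ws bs ps]]].
have [bS|bS] := boolP (tgt a \in Sp).
  pose v : {v : Q | v \in Sp} := exist _ (tgt a) bS.
  exists (sp_loop v :: sp_arrow Sp b :: s); split=> //=; first by rewrite ltnW.
  by rewrite -ab !eqxx.
exists (sp_arrow Sp b :: s); split=> //=; first by rewrite -ab eqxx.
by move: nz; rewrite /hat_pass (negbTE bS) /= => ->.
Qed.

(** This is where finite-dimensionality of the algebra of the quiver with loops
    enters: by [insert_loops] its nonzero paths are at least as long. *)
Lemma hat_walk_bounded : exists m, forall a w, path hat_step a w -> (size w < m)%N.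
Proof.
have [_ /(finite_dim_bound sp_gen sp_dead sp_zrel_ideal)[m mP]] := Spadm.
exists m => a w /insert_loops[s [ws bs ps]].
have [|p _ pE] := @qpath_of (sp_quiver Sp) (src a) (sp_arrow Sp a :: s).
  by rewrite /= eqxx.
apply: leq_ltn_trans ws _; apply: ltn_trans (mP p _); rewrite /plen pE //=.
by rewrite negbK.
Qed.

Lemma gentle_path_hat_path a w : path gentle_step a w -> path hat_step a w.
Proof.
by apply: sub_path => x y /andP[xy nz]; rewrite /hat_step /hat_pass xy nz orbT.
Qed.

(** By [special_zero] every passage through a special vertex is a zero relation,
    so the steps gained by dropping these relations are all such passages. *)
Lemma hat_step_split a b :
  hat_step a b = (gentle_step a b + ((tgt a == src b) && (src b \in Sp)))%N :> nat.
Proof.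
rewrite /hat_step /hat_pass /gentle_step; case: eqP => //= ab; rewrite -ab.
case aS : (tgt a \in Sp) => /=; last by rewrite addn0.
by rewrite special_zero.
Qed.

(** * Paths of the skewed-gentle algebra *)

Local Notation hQ := (hat_quiver Sp).
Local Notation hI := (hat_ideal I Sp).
Local Notation au := (@arrow_under Q Sp).

Lemma under_src (t : arrow hQ) : under (src t) = src (au t).
Proof. by have /andP[/eqP] := valP (t : hat_arrow Sp). Qed.

Lemma under_tgt (t : arrow hQ) : under (tgt t) = tgt (au t).
Proof. by have /andP[_ /eqP] := valP (t : hat_arrow Sp). Qed.

Lemma hat_arrow_eq (s t : arrow hQ) :
  src s = src t -> au s = au t -> tgt s = tgt t -> s = t.
Proof.
move=> E1 E2 E3; apply: (@val_inj _ _ (hat_arrow Sp)); move: E1 E2 E3.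
rewrite /arrow_under /=; case: (val s) => [[x a] y]; case: (val t) => [[x' a'] y'] /=.
by move=> -> -> ->.
Qed.

Lemma hat_arrow_over a (x y : hQ) : under x = src a -> under y = tgt a ->
  exists t : arrow hQ, [/\ src t = x, au t = a & tgt t = y].
Proof.
move=> xa ya; have t : (under (x, a, y).1.1 == src (x, a, y).1.2) &&
    (under (x, a, y).2 == tgt (x, a, y).1.2) by rewrite /= xa ya !eqxx.
by exists (exist _ (x, a, y) t).
Qed.

Lemma under_surj v : exists x : hQ, under x = v.
Proof.
have [vS|vS] := boolP (v \in Sp); first by exists (inr (exist _ v vS, true)).
by exists (inl (exist _ v vS)).
Qed.

Lemma card_under i : #|[pred x : hat_vertex Sp | under x == i]| = (i \in Sp).+1.
Proof.
rewrite -sum1_card big_mkcond big_sumType /=.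
have [iS|iS] := boolP (i \in Sp).
  rewrite big1 => [|[v vS] _]; last first.
    by rewrite inE /=; case: eqP => // vi; rewrite vi iS in vS.
  rewrite add0n (bigD1 (exist _ i iS, true)) //= (bigD1 (exist _ i iS, false)) /=;
    last by rewrite xpair_eqE andbF.
  rewrite !inE /= eqxx big1 // => -[[v vS] b] /andP[v1 v2]; rewrite inE /=.
  case: eqP => // vi; subst v; rewrite (bool_irrelevance vS iS) in v1 v2.
  by case: b v1 v2; rewrite eqxx.
rewrite addnC big1 => [|[[v vS] b] _]; last first.
  by rewrite inE /=; case: eqP => // vi; rewrite vi (negbTE iS) in vS.
rewrite add0n (bigD1 (exist _ i iS)) //= inE /= eqxx big1 // => -[v vS] vi.
rewrite inE /=; case: eqP => // E; subst v.
by rewrite (bool_irrelevance vS iS) eqxx in vi.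
Qed.

Lemma walk_end_under (x : hQ) s : under (walk_end x s) = walk_end (under x) (map au s).
Proof. by elim: s x => [//|t s IH] x; rewrite [LHS](IH (@tgt hQ t)) under_tgt. Qed.

Lemma walk_under (x : hQ) s : walk x s -> walk (under x) (map au s).
Proof.
elim: s x => [//|t s IH] x /andP[/eqP <- /IH ts].
by apply/andP; split; [rewrite under_src | rewrite -under_tgt].
Qed.

(** Any choice of vertices over the interior vertices lifts the walk, since every
    pair of vertices over the ends of an arrow is joined by an arrow over it. *)
Lemma lift_walk i a w (x y : hQ) : under x = i -> walk i (a :: w) ->
  under y = tgt (last a w) ->
  exists s, [/\ walk x s, walk_end x s = y & map au s = a :: w].
Proof.
elim: w i a x => [|b w IH] i a x xi /= /andP[/eqP ai aw] yw.
  have [||t [tx ta ty]] := @hat_arrow_over a x y; rewrite ?ai //.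
  by exists [:: t]; rewrite walk_cons walk_end_cons map_cons ta tx ty eqxx.
have [z za] := under_surj (tgt a).
have [s [zs sy sE]] := IH (tgt a) b z za aw yw.
have [||t [tx ta tz]] := @hat_arrow_over a x z; rewrite ?ai //.
exists (t :: s).
by rewrite walk_cons walk_end_cons map_cons ta tx tz eqxx sE.
Qed.

(** The commutation relations identify two paths as soon as they have the same end
    points and lie over the same path of [Q], so only the end points of a path
    remember the sign at a special vertex. *)
Definition hat_key (p : qpath hQ) := (pstart p, map au (parrows p), pend p).
Definition hat_dead (p : qpath hQ) := ~~ sorted hat_pass (map au (parrows p)).

Lemma hat_congruence : path_congruence hat_key hat_dead.
Proof.
split; try by move=> p q [].
- by move=> p q [_ /(congr1 size)]; rewrite !size_map.
- by move=> p q [_ E _]; rewrite /hat_dead E.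
- move=> p p' q q' r r' [p1 p2 _] [_ q2 q3].
  move=> /pcat_some[_ r1 r2 r3] /pcat_some[_ r1' r2' r3'].
  by rewrite /hat_key r1 r2 r3 r1' r2' r3' !map_cat p1 p2 q2 q3.
- move=> p q r + /pcat_some[_ _ _ rE]; rewrite /hat_dead rE map_cat.
  by apply: contraNN => /cat_sorted2[].
- move=> p q r + /pcat_some[_ _ _ rE]; rewrite /hat_dead rE map_cat.
  by apply: contraNN => /cat_sorted2[].
Qed.

Lemma under_fiber (x y : hat_vertex Sp) : under x = under y -> x <> y ->
  exists v b, x = inr (v, b) /\ y = inr (v, ~~ b).
Proof.
case: x y => [v|[v b]] [w|[w c]] /= vw ne.
- by case: ne; congr (inl _); apply: val_inj.
- by case/negP: (valP v); rewrite /= vw (valP w).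
- by case/negP: (valP w); rewrite /= -vw (valP v).
have E : v = w by apply: val_inj.
by exists v, b; rewrite E; move: ne; rewrite E; case: b; case: c.
Qed.

(** The two middle vertices are the two vertices over the same special vertex, so
    up to sign this is one of the defining commutation relations. *)
Lemma mesh_ideal (s t s' t' : arrow hQ) : au s = au s' -> au t = au t' ->
  src s = src s' -> tgt t = tgt t' -> tgt s = src t -> tgt s' = src t' ->
  tgt s <> tgt s' -> hI (arr K s * arr K t - arr K s' * arr K t').
Proof.
move=> ss tt s0 t0 st st' ne.
have E : under (tgt s) = under (tgt s') by rewrite !under_tgt ss.
have st_Q : tgt (au s) = src (au t) by rewrite -under_tgt st under_src.
have [v [b [Es Es']]] := under_fiber E ne.
(* The commutation relations are oriented from the positive to the negative
   vertex. *)
wlog bT : s t s' t' b ss tt s0 t0 st st' ne E st_Q Es Es' / b = true.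
  move=> W; case: b Es Es' => Es Es'.
    by apply: (W s t s' t' true).
  rewrite -opprB -sub0r; have [I0 IB _ _] := idealP hI; apply: IB => //.
  apply: (W s' t' s t true) => //; first by move/esym.
  by rewrite -ss -tt.
rewrite bT in Es Es'; have aS : tgt (au s) \in Sp by rewrite -under_tgt Es (valP v).
have av : tgt (au s) = val v by rewrite -under_tgt Es.
move=> H [_]; apply; right; exists v, (au s), (au t), s, t, s', t'.
split; first split=> //.
- by rewrite -av (special_valency aS st_Q).
- exact/asboolP/special_zero.
by rewrite -st -st'.
Qed.

(** Two paths over the same path are compared from left to right.  If their second
    vertices differ, a commutation relation replaces the first two arrows
    [t' t2'] of [q] by [t t2''], where [t2''] joins the end of [t] to the end of
    [t2'].  Then both paths begin with [t], and it remains to compare the rest. *)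
Lemma hat_key_ideal p q : hat_key p = hat_key q -> hI (pathE K p - pathE K q).
Proof.
have [I0 IB Il Ir] := idealP hI.
move: {2}(parrows p) (erefl (parrows p)) => s; elim: s p q => [|t s IH] p q ps pq.
  have [E1 E2 _] := pq; rewrite ps /= in E2.
  by rewrite (@qpath_eq _ p q) ?subrr // ps; case: (parrows q) E2.
have [E1 E2 E3] := pq; rewrite ps in E2.
case qs: (parrows q) E2 => [|t' s'] // [tt ss'].
have [p1 [-> pt p1t p1s]] := pathE_cons K ps.
have [q1 [-> qt q1t q1s]] := pathE_cons K qs.
have p1e : pend p1 = pend p by rewrite /pend p1t p1s ps.
have q1e : pend q1 = pend q by rewrite /pend q1t q1s qs.
have t0 : src t = src t' by rewrite -pt -qt.
have [tgt_eq|/eqP tgt_ne] := eqVneq (tgt t) (tgt t').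
  rewrite (hat_arrow_eq t0 tt tgt_eq) -mulrBr; apply: (Il); apply: IH => //.
  by rewrite /hat_key p1t q1t p1s q1s tgt_eq ss' p1e q1e E3.
case: s' qs ss' q1s => [|t2' s'] qs ss' q1s.
  case: s {IH} ps ss' p1s => // ps _ p1s; case: tgt_ne.
  have -> : tgt t = pend p1 by rewrite /pend p1s p1t.
  by rewrite p1e E3 -q1e /pend q1s q1t.
have [q2 [-> q1t2 q2t q2s]] := pathE_cons K q1s.
case: s IH ps ss' p1s => [|t2 s] // IH ps [tt2 ss'] p1s.
have [||t2'' [u0 u1 u2]] := @hat_arrow_over (au t2') (tgt t) (tgt t2').
- by rewrite under_tgt tt -under_tgt -q1t q1t2 under_src.
- by rewrite under_tgt.
have [|q1' q1't q1's] := @qpath_of hQ (tgt t) (t2'' :: s').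
  by rewrite walk_cons u0 eqxx u2 -q2t -q2s qpath_walk.
have [q2' [q1'E _ q2't q2's]] := pathE_cons K q1's.
have q2E : q2' = q2 by apply: qpath_eq; rewrite ?q2't ?q2t ?u2 // q2's q2s.
(* Both summands lie in the ideal: the first one by induction, the second one
   as a multiple of a commutation relation. *)
rewrite -[arr K t * _](subrK (arr K t * pathE K q1')) -mulrBr -addrA.
apply: idealD.
  apply: (Il); apply: IH; first by rewrite p1s.
  rewrite /hat_key p1t q1't p1s q1's /= tt2 ss' u1 p1e E3 -q1e; congr (_, _).
  by rewrite /pend q1t q1s q1't q1's !walk_end_cons u2.
rewrite q1'E q2E !mulrA -mulrBl; apply: (Ir); apply: mesh_ideal => //.
by rewrite -q1t.
Qed.

Lemma hat_red x : hI x <-> path_lin (nf hat_key hat_dead) x = 0.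
Proof.
apply: (ideal_red hat_congruence (J := hI)
  (G := (@hat_zero_relations K Q I Sp `|` @hat_mesh_relations K Q I Sp)%classic)).
- by [].
- move=> g [[s [t [[ab zab] nS st ->]]]|].
    have z : zrel (au s) (au t) by apply/asboolP.
    have [p -> [_ ps]] := arr_mul K st; rewrite red_path /nf.
    by rewrite (_ : hat_dead p) // /hat_dead ps /= /hat_pass (negbTE nS) z.
  move=> [v [a [b [s [t [s' [t' [_ [[sa tb sa' tb']]]]]]]]]].
  move=> [[s0 t0 [s1 t1] [s1' t1']] ->].
  have [p -> [p0 ps]] := @arr_mul K _ s t (etrans s1 (esym t1)).
  have [q -> [q0 qs]] := @arr_mul K _ s' t' (etrans s1' (esym t1')).
  rewrite redD redN !red_path.
  rewrite (@nf_key _ _ _ _ hat_congruence p q) ?subrr //.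
  by rewrite /hat_key /pend p0 ps q0 qs !walk_end_cons !map_cons s0 t0 sa tb sa' tb'.
- move=> p dp; apply: (ideal_dead (Z := fun s t => ~~ hat_pass (au s) (au t))).
    move=> s t; rewrite /hat_pass negb_or negbK => /andP[nS /asboolP z] st H [_].
    by apply; left; exists s, t.
  move: dp; rewrite /hat_dead sorted_map; apply: contraNN.
  by apply: sub_sorted => s t; rewrite negbK.
- exact: hat_key_ideal.
Qed.

(** The normal paths from [x] to [y] correspond to the paths of [Q] between the
    vertices below whose zero relations all sit at special vertices. *)
Lemma hat_cartan m (x y : hQ) :
  (forall a w, path hat_step a w -> (size w < m)%N) ->
  let c := (x == y)%:R + path_poly m hat_step (under x) (under y) in
  qcartan_entry hI x y = c /\ (Defs.dim (@peirce K hQ hI x y))%:Z = c.[1].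
Proof.
move=> bounded c.
pose P w : set (qpath hQ) := [set p | [/\ normal hat_key hat_dead p, pstart p = x,
  pend p = y & map au (parrows p) = w]]%classic.
have ws i a w : (src a == i) && path hat_step a w =
    walk i (a :: w) && sorted hat_pass (a :: w) by apply: walk_sorted.
have P_len n w : w \in walk_seqs hat_step (x == y) (under x) (under y) n -> size w = n.
  by rewrite mem_walk_seqs => /andP[/eqP].
have P_ex n w : w \in walk_seqs hat_step (x == y) (under x) (under y) n ->
    exists p, P w p.
  rewrite mem_walk_seqs => /andP[_ wP].
  have [s [xs sy sw sw']] : exists s, [/\ walk x s, walk_end x s = y, map au s = w
      & sorted hat_pass w].
    case: w wP => [/eqP <-|a w]; first by exists [::].
    rewrite andbA ws => /andP[/andP[iw sw] /eqP wy].
    by have [s [? ? ?]] := lift_walk erefl iw (esym wy); exists s.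
  have [p px pE] := qpath_of xs.
  case E: (nf hat_key hat_dead p) => [q|]; last first.
    by move: E; rewrite /nf /hat_dead pE sw sw'.
  have [q1 q2 q3] := key_nf E; exists q; split.
  - exact: (nf_normal hat_congruence E).
  - by rewrite q1.
  - by rewrite q3 /pend px pE.
  - by rewrite q2 pE.
pose f w := xget (triv_path x) (P w).
apply: (cartan_entry hat_congruence hat_red
  (W := walk_seqs hat_step (x == y) (under x) (under y))
  (f := f) (g := fun p => map au (parrows p))).
- by move=> n; apply: walk_seqs_uniq.
- move=> n w wW; have [fN fx fy fw] := xgetPex (triv_path x) (P_ex n w wW).
  by split=> //; have := congr1 size fw; rewrite size_map (P_len n w wW).
- move=> p pN px py; split; last first.
    have [fN fx fy fw] : P (map au (parrows p)) (f (map au (parrows p))).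
      by apply: xgetPex; exists p.
    have : hat_key (f (map au (parrows p))) = hat_key p.
      by rewrite /hat_key fx fy fw px py.
    by move=> /(nf_key hat_congruence); rewrite (eqP fN) (eqP pN) => -[].
  rewrite mem_walk_seqs size_map eqxx /=.
  have pw := walk_under (qpath_walk p).
  have pe : under y = walk_end (under x) (map au (parrows p)).
    by rewrite -walk_end_under -px -py.
  have ps : sorted hat_pass (map au (parrows p)).
    by move: pN; rewrite /normal /nf /hat_dead; case: (sorted _ _).
  case E: (parrows p) pw pe ps => [|t s] pw pe ps; first by rewrite -px -py /pend E /=.
  rewrite /= in pw ps pe *; rewrite andbA ws -px /= pw ps.
  by rewrite pe walk_end_last eqxx.
- by move=> n; apply: coef_path_poly.
Qed.

End Skewed.

(** * Equality of the Cartan determinants *)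

Theorem corollary4 (K : fieldType) (Q : quiver) (I : ideal (path_algebra K Q))
    (Sp : {set Q}) :
  gentle I ->
  finite_dim (quotient_algebra I) ->
  admissible_special I Sp ->
  \det (qcartan (hat_ideal I Sp)) = \det (qcartan I) /\
  \det (cartan (hat_ideal I Sp)) = \det (cartan I).
Proof.
move=> Ig _ Spa; have [m hbound] := hat_walk_bounded Spa.
have nbound a w : path (gentle_step I) a w -> (size w < m)%N.
  by move/(gentle_path_hat_path Sp); apply: hbound.
have [G [IG Gd]] := gentle_presentation Ig.
have zI a b : zrel I a b -> tgt a = src b -> I (arr K a * arr K b) by move=> /asboolP[].
have QE i j := monomial_cartan IG Gd zI i j (fun a b => erefl) nbound.
have HE x y := hat_cartan Spa x y hbound.
have qQ : qcartan I = fmx (fun i j => (i == j)%:R + path_poly m (gentle_step I) i j).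
  by apply/matrixP => i j; rewrite !mxE; have [-> _] := QE (enum_val i) (enum_val j).
have qH : qcartan (hat_ideal I Sp) = fmx (fun x y : hat_quiver Sp =>
    (x == y)%:R + path_poly m (hat_step I Sp) (under x) (under y)).
  by apply/matrixP => i j; rewrite !mxE; have [-> _] := HE (enum_val i) (enum_val j).
have cQ : cartan I = map_mx (horner_eval 1) (qcartan I).
  by apply/matrixP => i j; rewrite !mxE; have [-> ->] := QE (enum_val i) (enum_val j).
have cH : cartan (hat_ideal I Sp) = map_mx (horner_eval 1) (qcartan (hat_ideal I Sp)).
  by apply/matrixP => i j; rewrite !mxE; have [-> ->] := HE (enum_val i) (enum_val j).
have E : \det (qcartan (hat_ideal I Sp)) = \det (qcartan I).
  rewrite qQ qH; apply: (det_path_poly nbound hbound (hat_step_split Spa)).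
  exact: card_under.
by rewrite cQ cH !det_map_mx E.
Qed.
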